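(* Let $\alpha\in(0,1)$, $T>0$, $\mathcal{A}\in\mathbb{C}^{d\times d}$, $x_0\in\mathbb{C}^d$, and $\vartheta(t)=\sum_{n=0}^\infty\vartheta_nt^n$ with $\vartheta_n\in\mathbb{C}^d$ and $\sum_n|\vartheta_n|T^n<\infty$. Then $$x(t)=\mathcal{E}_\alpha(\mathcal{A}t)x_0+\sum_{n=0}^\infty\sum_{k=0}^{n-1}\mathcal{A}^k\frac{\prod_{j=n-k}^n\Gamma(j-\alpha+1)}{\Gamma(2-\alpha)^{k+1}\prod_{j=n-k}^n\Gamma(j+1)}\vartheta_{n-k-1}\,t^n$$ satisfies $x(0)=x_0$ and ${}^LD^\alpha x(t)=\mathcal{A}x(t)+\vartheta(t)$ for every $t\in[0,T]$.
   Context: $\mathcal{E}_\alpha(s)=\sum_{n=0}^\infty\frac{s^n}{\Gamma(2-\alpha)^n\prod_{j=1}^n\frac{\Gamma(j+1)}{\Gamma(j+1-\alpha)}}$ (matrix arguments allowed). Empty sums are $0$. Caputo derivative ${}^CD^\alpha x(t)=\frac{1}{\Gamma(1-\alpha)}\int_0^t (t-\tau)^{-\alpha}x'(\tau)d\tau$; L-fractional derivative ${}^LD^\alpha x(t)=\frac{\Gamma(2-\alpha)}{t^{1-\alpha}}{}^CD^\alpha x(t)$ for $t>0$, extended to $t=0$ by continuity (value $x'(0)$) for $C^2$ functions. *)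

(* Defs.v *)
From Stdlib Require Import Reals.
From Coquelicot Require Import Coquelicot.

Open Scope R_scope.

(* Euler's Gamma function, Gamma(s) = \int_0^\infty t^(s-1) e^(-t) dt
   (improper Riemann integral; only used for s > 0). *)
Definition Gamma (s : R) : R :=
  RInt_gen (fun t => Rpower t (s - 1) * exp (- t)) (at_right 0) (Rbar_locally p_infty).

Fixpoint prodR (f : nat -> R) (m len : nat) : R :=
  match len with
  | O => 1
  | S l => f m * prodR f (S m) l
  end.

Fixpoint sumC (n : nat) (f : nat -> C) : C :=
  match n with
  | O => RtoC 0
  | S m => Cplus (sumC m f) (f m)
  end.

Fixpoint sumR (n : nat) (f : nat -> R) : R :=
  match n with
  | O => 0
  | S m => sumR m f + f m
  end.

(* Vectors of C^d are functions nat -> C (entries 0..d-1 relevant);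
   d x d matrices are functions nat -> nat -> C. *)
Definition mvmul (d : nat) (A : nat -> nat -> C) (v : nat -> C) : nat -> C :=
  fun i => sumC d (fun j => Cmult (A i j) (v j)).

Definition mmul (d : nat) (A B : nat -> nat -> C) : nat -> nat -> C :=
  fun i j => sumC d (fun k => Cmult (A i k) (B k j)).

Definition idm : nat -> nat -> C :=
  fun i j => if Nat.eqb i j then RtoC 1 else RtoC 0.

Fixpoint mpow (d : nat) (A : nat -> nat -> C) (k : nat) : nat -> nat -> C :=
  match k with
  | O => idm
  | S k' => mmul d A (mpow d A k')
  end.

Definition vnorm (d : nat) (v : nat -> C) : R :=
  sqrt (sumR d (fun i => Cmod (v i) ^ 2)).

Definition Ecoef (a : R) (n : nat) : R :=
  / (Gamma (2 - a) ^ n * prodR (fun j => Gamma (INR j + 1) / Gamma (INR j + 1 - a)) 1 n).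

Definition is_Emat (d : nat) (a : R) (A : nat -> nat -> C) (t : R)
  (E : nat -> nat -> C) : Prop :=
  forall i j, (i < d)%nat -> (j < d)%nat ->
    is_series (fun n => Cmult (RtoC (Ecoef a n * t ^ n)) (mpow d A n i j)) (E i j).

Definition Scoef (a : R) (n k : nat) : R :=
  prodR (fun j => Gamma (INR j - a + 1)) (n - k) (S k)
  / (Gamma (2 - a) ^ (S k) * prodR (fun j => Gamma (INR j + 1)) (n - k) (S k)).

Definition Sterm (d : nat) (a : R) (A : nat -> nat -> C) (theta : nat -> nat -> C)
  (t : R) (n : nat) : nat -> C :=
  fun i => sumC n (fun k =>
    Cmult (RtoC (Scoef a n k * t ^ n)) (mvmul d (mpow d A k) (theta (n - k - 1)%nat) i)).

Definition is_Caputo (a : R) (y : R -> C) (t : R) (v : C) : Prop :=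
  exists y' : R -> C,
    (forall tau, 0 < tau < t -> is_derive y tau (y' tau)) /\
    exists I : C,
      is_RInt_gen (fun tau => scal (Rpower (t - tau) (- a)) (y' tau))
        (at_right 0) (at_left t) I /\
      v = scal (/ Gamma (1 - a)) I.

(* L-fractional derivative: for t > 0, Gamma(2-a)/t^(1-a) * Caputo derivative;
   at t = 0 its value is y'(0) (right derivative, y being considered on [0,T]). *)
Definition is_LD (a : R) (y : R -> C) (t : R) (v : C) : Prop :=
  (0 < t -> exists c, is_Caputo a y t c /\ v = scal (Gamma (2 - a) / Rpower t (1 - a)) c) /\
  (t = 0 -> filterlim (fun h => scal (/ h) (minus (y h) (y 0))) (at_right 0) (locally v)).

(* Main.v *)
Require Import Defs.
From Stdlib Require Import Reals Lra Lia.
From Coquelicot Require Import Coquelicot.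

Open Scope R_scope.

(** A power series x(t) = sum x_n t^n solves the equation as soon as
    x_(n+1) = c_(n+1) (A x_n + theta_n) with
    c_n = Gamma(n+1-a) / (Gamma(2-a) Gamma(n+1)), because the L-derivative maps
    t^n to t^(n-1) / c_n; the coefficients of the stated formula satisfy this
    recurrence.  Since c_n = O(n^(-a)) tends to 0, sum |x_n| T^n converges.
    The Caputo integral of x' may be computed termwise up to t = T, even though
    the series of x' need not converge there: the integrals of the terms over
    [p,q] in (0,t) are dominated by their values on (0,t), which are multiples
    of |A x_n + theta_n| t^n, so dominated convergence for series
    applies as p -> 0 and q -> t. *)

(** * Limits of series and improper integrals *)

(** [RInt_gen] returns some value even for a divergent integral, so nothing is known about [Gamma]
    until convergence is proved. Only positivity, [Gamma 1 = 1] and the functional equation are then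
    used. The functional equation makes c_(n+1) / c_n = 1 - a/(n+1), which yields the decay rate
    without Stirling's formula; a recursive primitive of s^n (t - s)^(-a) evaluates the Caputo
    integral of a monomial without the Beta function. A ratio test does not apply to the
    coefficients: they may vanish, and theta_n is constrained by summability alone. Instead, however
    large A and T are, the decay of c_n eventually gives |x_(n+1)| T^(n+1) <= |x_n| T^n / 2 +
    |theta_n| T^n. The columns of the matrix series, the double sum and x itself obey recurrences of
    this one shape, so a single summability lemma covers all three. *)

Lemma series_tail_le (u m : nat -> R) (N : nat) :
  (forall n, Rabs (u n) <= m n) -> ex_series m ->
  Rabs (Series u - sum_n u N) <= Series m - sum_n m N.
Proof.
  intros Hum Hm.
  assert (Hu : ex_series (fun n => Rabs (u n))).
  { apply (ex_series_le (K := R_AbsRing) (V := R_CompleteNormedModule) _ m); [|exact Hm].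
    intros n. unfold norm; simpl. unfold abs; simpl. now rewrite Rabs_Rabsolu. }
  assert (Hu' : ex_series u) by now apply ex_series_Rabs.
  rewrite (Series_incr_n u (S N)) by (try lia; assumption).
  rewrite (Series_incr_n m (S N)) by (try lia; assumption).
  rewrite !sum_n_Reals. simpl pred.
  replace (sum_f_R0 u N + Series (fun k => u (S N + k)%nat) - sum_f_R0 u N)
    with (Series (fun k => u (S N + k)%nat)) by ring.
  replace (sum_f_R0 m N + Series (fun k => m (S N + k)%nat) - sum_f_R0 m N)
    with (Series (fun k => m (S N + k)%nat)) by ring.
  eapply Rle_trans.
  - apply Series_Rabs. apply (ex_series_incr_n (fun n => Rabs (u n)) (S N)), Hu.
  - apply Series_le.
    + intros n; split; [apply Rabs_pos|apply Hum].
    + apply (ex_series_incr_n m (S N)), Hm.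
Qed.

Lemma series_tail_small (m : nat -> R) (eps : posreal) :
  ex_series m -> eventually (fun N => Series m - sum_n m N < eps).
Proof.
  intros Hm. apply Series_correct in Hm.
  destruct (proj1 (filterlim_locally _ _) Hm eps) as [N HN].
  exists N. intros n Hn. pose proof (HN n Hn) as H.
  change (Rabs (sum_n m n - Series m) < eps) in H.
  apply Rabs_def2 in H. lra.
Qed.

Lemma filterlim_R_eps {T : Type} (F : (T -> Prop) -> Prop) {FF : Filter F}
  (f : T -> R) (l : R) :
  (forall eps : posreal, F (fun x => Rabs (f x - l) < eps)) ->
  filterlim f F (locally l).
Proof. intros H. apply filterlim_locally. exact H. Qed.

Lemma filterlim_R_eps_inv {T : Type} (F : (T -> Prop) -> Prop) {FF : Filter F}
  (f : T -> R) (l : R) :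
  filterlim f F (locally l) ->
  forall eps : posreal, F (fun x => Rabs (f x - l) < eps).
Proof. intros H eps. exact (proj1 (filterlim_locally f l) H eps). Qed.

Lemma filterlim_sum_n {T : Type} (F : (T -> Prop) -> Prop) {FF : Filter F}
  (h : nat -> T -> R) (l : nat -> R) (N : nat) :
  (forall n, filterlim (h n) F (locally (l n))) ->
  filterlim (fun u => sum_n (fun n => h n u) N) F (locally (sum_n l N)).
Proof.
  intros H. induction N as [|N IH].
  - rewrite sum_O. apply filterlim_ext with (h 0%nat); [|apply H].
    intros x. now rewrite sum_O.
  - rewrite sum_Sn.
    apply filterlim_ext with (fun u => plus (sum_n (fun n => h n u) N) (h (S N) u)).
    { intros x. now rewrite sum_Sn. }
    eapply filterlim_comp_2; [exact IH|apply H|].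
    apply (filterlim_plus (K := R_AbsRing) (V := R_NormedModule)).
Qed.

(** Up to eps, the two tails are controlled by the tail of [m] and the head is a finite sum of
    convergent terms. The bound on [l] is a separate hypothesis because [F] is not assumed proper,
    so limits along it need not inherit bounds. *)
Lemma tannery {T : Type} (F : (T -> Prop) -> Prop) {FF : Filter F}
  (h : nat -> T -> R) (l m : nat -> R) :
  F (fun u => forall n, Rabs (h n u) <= m n) ->
  (forall n, filterlim (h n) F (locally (l n))) ->
  (forall n, Rabs (l n) <= m n) -> ex_series m ->
  filterlim (fun u => Series (fun n => h n u)) F (locally (Series l)).
Proof.
  intros Hh Hl Hlm Hm. apply filterlim_R_eps; [exact FF|]. intros eps.
  assert (He : 0 < eps / 3) by (generalize (cond_pos eps); lra).
  destruct (series_tail_small m (mkposreal _ He) Hm) as [N HN].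
  specialize (HN N (Nat.le_refl N)). simpl in HN.
  generalize (filterlim_R_eps_inv F _ _ (filterlim_sum_n F h l N Hl) (mkposreal _ He)).
  intros Hs. generalize (filter_and _ _ Hh Hs). apply filter_imp.
  intros u [Hu Hu2]. simpl in Hu2.
  pose proof (series_tail_le _ m N Hu Hm) as H1.
  pose proof (series_tail_le _ m N Hlm Hm) as H2.
  apply Rabs_def2 in Hu2. apply Rabs_le_between in H1. apply Rabs_le_between in H2.
  apply Rabs_def1; lra.
Qed.

(** Weierstrass test: the tail of [m] bounds the remainder independently of x, so the partial sums
    converge uniformly. *)
Lemma is_RInt_series (f : nat -> R -> R) (I m : nat -> R) (a b : R) :
  a <= b ->
  (forall n, is_RInt (f n) a b (I n)) ->
  (forall n x, a <= x <= b -> Rabs (f n x) <= m n) ->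
  ex_series m ->
  is_RInt (fun x => Series (fun n => f n x)) a b (Series I).
Proof.
  intros Hab Hf Hm Hex.
  (* [filterlim_RInt] asks for uniform convergence on the whole line *)
  set (clip := fun x => Rmax a (Rmin b x)).
  assert (Hclip : forall x, a <= clip x <= b).
  { intros x. unfold clip. split; [apply Rmax_l|]. apply Rmax_lub; [exact Hab|apply Rmin_l]. }
  assert (Hclip' : forall x, Rmin a b < x < Rmax a b -> clip x = x).
  { intros x. rewrite Rmin_left, Rmax_right by exact Hab. intros Hx. unfold clip.
    rewrite (Rmin_right b x) by lra. apply Rmax_right; lra. }
  destruct (filterlim_RInt (U := nat) (V := R_CompleteNormedModule)
    (fun N x => sum_n (fun n => f n (clip x)) N) a b eventually _
    (fun x => Series (fun n => f n (clip x))) (fun N => sum_n I N)) as [L [HL1 HL2]].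
  - intros N. induction N as [|N IH].
    + rewrite sum_O. apply is_RInt_ext with (f 0%nat); [|apply Hf].
      intros x Hx. now rewrite sum_O, Hclip'.
    + rewrite sum_Sn.
      apply is_RInt_ext with (fun x => plus (sum_n (fun n => f n (clip x)) N) (f (S N) x)).
      { intros x Hx. rewrite sum_Sn, (Hclip' x Hx). reflexivity. }
      apply (is_RInt_plus (V := R_NormedModule)); [exact IH|apply Hf].
  - apply filterlim_locally. intros eps.
    generalize (series_tail_small m eps Hex). apply filter_imp. intros N HN x.
    change (Rabs (sum_n (fun n => f n (clip x)) N - Series (fun n => f n (clip x))) < eps).
    rewrite Rabs_minus_sym.
    eapply Rle_lt_trans; [|exact HN].
    apply series_tail_le; [|exact Hex]. intros n. apply Hm, Hclip.
  - apply is_RInt_ext with (fun x => Series (fun n => f n (clip x))).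
    { intros x Hx. now rewrite Hclip'. }
    assert (HI : Series I = L) by (apply is_series_unique; exact HL1).
    rewrite HI. exact HL2.
Qed.

(** [is_RInt_gen] quantifies existentially over the value of each proper integral. Naming these
    values by [h] splits the goal into a computation and an ordinary limit. *)
Lemma is_RInt_gen_intro {V : NormedModule R_AbsRing} (f : R -> V)
  (Fa Fb : (R -> Prop) -> Prop) {FFa : Filter Fa} {FFb : Filter Fb} (h : R * R -> V) (l : V) :
  filter_prod Fa Fb (fun ab => is_RInt f (fst ab) (snd ab) (h ab)) ->
  filterlim h (filter_prod Fa Fb) (locally l) ->
  is_RInt_gen f Fa Fb l.
Proof.
  intros H1 H2 P HP.
  unfold filtermapi.
  apply (filter_imp (fun ab => is_RInt f (fst ab) (snd ab) (h ab) /\ P (h ab))).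
  2: { apply filter_and; [exact H1|exact (H2 P HP)]. }
  intros ab [Ha Hb]. exists (h ab). split; assumption.
Qed.

Lemma filterlim_primitive (F : R -> R) (Fa Fb : (R -> Prop) -> Prop)
  {FFa : Filter Fa} {FFb : Filter Fb} (la lb : R) :
  filterlim F Fa (locally la) -> filterlim F Fb (locally lb) ->
  filterlim (fun ab => F (snd ab) - F (fst ab)) (filter_prod Fa Fb) (locally (lb - la)).
Proof.
  intros Ha Hb. unfold Rminus.
  eapply (filterlim_comp_2 (fun ab => F (snd ab)) (fun ab => - F (fst ab)) Rplus).
  - eapply filterlim_comp; [apply filterlim_snd|exact Hb].
  - eapply (filterlim_comp _ _ _ (fun ab => F (fst ab)) Ropp).
    + eapply filterlim_comp; [apply filterlim_fst|exact Ha].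
    + apply (filterlim_opp (K := R_AbsRing) (V := R_NormedModule)).
  - apply (filterlim_plus (K := R_AbsRing) (V := R_NormedModule)).
Qed.

Lemma is_RInt_gen_primitive (F f : R -> R) (Fa Fb : (R -> Prop) -> Prop)
  {FFa : Filter Fa} {FFb : Filter Fb} (la lb : R) :
  filter_prod Fa Fb (fun ab => is_RInt f (fst ab) (snd ab) (F (snd ab) - F (fst ab))) ->
  filterlim F Fa (locally la) -> filterlim F Fb (locally lb) ->
  is_RInt_gen f Fa Fb (lb - la).
Proof.
  intros H Ha Hb. eapply is_RInt_gen_intro; [assumption|assumption|exact H|].
  now apply filterlim_primitive.
Qed.

(** * Real powers and one-sided neighbourhoods *)

Lemma is_derive_Rpower (p x : R) :
  0 < x -> is_derive (fun t => Rpower t p) x (p * Rpower x (p - 1)).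
Proof.
  intros Hx. unfold Rpower. auto_derive; [exact Hx|].
  replace ((p - 1) * ln x) with (p * ln x + - ln x) by ring.
  rewrite exp_plus, exp_Ropp, exp_ln by exact Hx. field. lra.
Qed.

Lemma Rpower_pos (x p : R) : 0 < Rpower x p.
Proof. apply exp_pos. Qed.

Lemma Rpower_add1 (x p : R) : 0 < x -> Rpower x (p + 1) = x * Rpower x p.
Proof. intros Hx. rewrite Rpower_plus, Rpower_1 by exact Hx. ring. Qed.

Lemma continuous_Rpower (p x : R) : 0 < x -> continuous (fun t => Rpower t p) x.
Proof.
  intros Hx. apply (ex_derive_continuous (V := R_NormedModule)).
  eexists. now apply is_derive_Rpower.
Qed.

Lemma filterlim_Rpower_0 (p : R) :
  0 < p -> filterlim (fun t => Rpower t p) (at_right 0) (locally 0).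
Proof.
  intros Hp. apply filterlim_R_eps; [apply within_filter; apply locally_filter|]. intros eps.
  exists (mkposreal _ (Rpower_pos eps (/ p))). intros t Ht Ht0.
  unfold ball in Ht; simpl in Ht. unfold AbsRing_ball, abs, minus, plus, opp in Ht; simpl in Ht.
  rewrite Rabs_right in Ht by lra.
  rewrite Rminus_0_r, Rabs_right by (apply Rle_ge, Rlt_le, Rpower_pos).
  replace (pos eps) with (Rpower (Rpower eps (/ p)) p).
  - apply Rlt_Rpower_l; [exact Hp|]. lra.
  - rewrite Rpower_mult. replace (/ p * p) with 1 by (field; lra).
    apply Rpower_1, cond_pos.
Qed.

Lemma at_right_0_pos : at_right 0 (fun a => 0 < a).
Proof. exists (mkposreal 1 Rlt_0_1). intros y _ Hy. exact Hy. Qed.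

Lemma at_right_0_lt (c : R) : 0 < c -> at_right 0 (fun a => 0 < a < c).
Proof.
  intros Hc. exists (mkposreal c Hc). intros y Hy Hy0.
  unfold ball in Hy; simpl in Hy. unfold AbsRing_ball, abs, minus, plus, opp in Hy; simpl in Hy.
  apply Rabs_def2 in Hy. lra.
Qed.

Lemma at_left_gt (c t : R) : c < t -> at_left t (fun b => c < b < t).
Proof.
  intros Hc. assert (H : 0 < t - c) by lra. exists (mkposreal _ H). intros y Hy Hy0.
  unfold ball in Hy; simpl in Hy. unfold AbsRing_ball, abs, minus, plus, opp in Hy; simpl in Hy.
  apply Rabs_def2 in Hy. lra.
Qed.

(** * The Gamma function *)

Definition gamma_integrand (s t : R) : R := Rpower t (s - 1) * exp (- t).

Lemma gamma_integrand_pos (s t : R) : 0 < gamma_integrand s t.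
Proof. apply Rmult_lt_0_compat; [apply Rpower_pos|apply exp_pos]. Qed.

Lemma gamma_integrand_continuous (s t : R) : 0 < t -> continuous (gamma_integrand s) t.
Proof.
  intros Ht. apply (continuous_mult (K := R_AbsRing)).
  - now apply continuous_Rpower.
  - apply (ex_derive_continuous (V := R_NormedModule)). auto_derive. exact I.
Qed.

Lemma gamma_integrand_ex_RInt (s a b : R) :
  0 < a -> a <= b -> ex_RInt (gamma_integrand s) a b.
Proof.
  intros Ha Hab. apply (ex_RInt_continuous (V := R_CompleteNormedModule)).
  rewrite Rmin_left by exact Hab. intros z Hz. apply gamma_integrand_continuous. lra.
Qed.

Lemma RInt_pos_subset (f : R -> R) (a' a b b' : R) :
  a' <= a -> a <= b -> b <= b' ->
  (forall x, a' < x < b' -> 0 <= f x) -> ex_RInt f a' b' ->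
  RInt f a b <= RInt f a' b'.
Proof.
  intros H1 H2 H3 Hf Hex.
  assert (E1 : ex_RInt f a' a) by (eapply (ex_RInt_Chasles_1 (V := R_CompleteNormedModule)); [|exact Hex]; lra).
  assert (E2 : ex_RInt f a b') by (eapply (ex_RInt_Chasles_2 (V := R_CompleteNormedModule)); [|exact Hex]; lra).
  assert (E3 : ex_RInt f a b) by (eapply (ex_RInt_Chasles_1 (V := R_CompleteNormedModule)); [|exact E2]; lra).
  assert (E4 : ex_RInt f b b') by (eapply (ex_RInt_Chasles_2 (V := R_CompleteNormedModule)); [|exact E2]; lra).
  rewrite <- (RInt_Chasles (V := R_CompleteNormedModule) f a' a b' E1 E2),
    <- (RInt_Chasles (V := R_CompleteNormedModule) f a b b' E3 E4).
  unfold plus; simpl.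
  assert (0 <= RInt f a' a) by (apply RInt_ge_0; try assumption; intros; apply Hf; lra).
  assert (0 <= RInt f b b') by (apply RInt_ge_0; try assumption; intros; apply Hf; lra).
  lra.
Qed.

(** For a nonnegative integrand the proper integrals grow with the interval, so their supremum is
    the improper integral: if none exceeded l - eps, then l - eps would be a smaller upper bound.
    The second conclusion later yields the positivity of Gamma. *)
Lemma is_RInt_gen_of_bounded (f : R -> R) (M : R) :
  (forall x, 0 < x -> 0 <= f x) ->
  (forall a b, 0 < a -> a <= b -> ex_RInt f a b) ->
  (forall a b, 0 < a -> a <= b -> RInt f a b <= M) ->
  exists l, is_RInt_gen f (at_right 0) (Rbar_locally p_infty) l /\
    forall a b, 0 < a -> a <= b -> RInt f a b <= l.
Proof.
  intros Hf Hex HM.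
  destruct (completeness (fun y => exists a b, 0 < a /\ a <= b /\ y = RInt f a b))
    as [l [Hub Hlub]].
  - exists M. intros y (a & b & Ha & Hab & ->). now apply HM.
  - exists (RInt f 1 1), 1, 1. repeat split; lra.
  - exists l. split; [|intros a b Ha Hab; apply Hub; now exists a, b].
    apply is_RInt_gen_intro with (fun ab => RInt f (fst ab) (snd ab)); try apply _.
    + exists (fun a => 0 < a < 1) (fun b => 1 < b).
      * apply at_right_0_lt, Rlt_0_1.
      * now exists 1.
      * intros a b Ha Hb. simpl.
        apply (RInt_correct (V := R_CompleteNormedModule)), Hex; lra.
    + apply filterlim_R_eps; [apply _|]. intros eps.
      destruct (Classical_Prop.classic
        (exists a b, 0 < a /\ a <= b /\ l - eps < RInt f a b)) as [(a0 & b0 & Ha0 & Hab0 & Hl)|Hn].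
      * exists (fun a => 0 < a < a0) (fun b => b0 < b).
        -- now apply at_right_0_lt.
        -- now exists b0.
        -- intros a b Ha Hb. simpl.
           assert (RInt f a b <= l) by (apply Hub; exists a, b; repeat split; lra).
           assert (RInt f a0 b0 <= RInt f a b).
           { apply RInt_pos_subset; try lra.
             - intros x Hx; apply Hf; lra.
             - apply Hex; lra. }
           generalize (cond_pos eps). intros. apply Rabs_def1; lra.
      * exfalso. assert (l <= l - eps); [|generalize (cond_pos eps); lra].
        apply Hlub. intros y (a & b & Ha & Hab & ->).
        apply Rnot_lt_le. intros H. apply Hn. now exists a, b.
Qed.

(* The integrand is dominated by a multiple of the derivative of the bounded
   function t^s / (1 + t^s). *)
Lemma gamma_integrand_RInt_le (s a b : R) :
  0 < s <= 1 -> 0 < a -> a <= b -> RInt (gamma_integrand s) a b <= 4 / s.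
Proof.
  intros Hs Ha Hab.
  set (F := fun t => 4 / s * (Rpower t s / (1 + Rpower t s))).
  set (F' := fun t => 4 * Rpower t (s - 1) / (1 + Rpower t s) ^ 2).
  assert (HF : is_RInt F' a b (F b - F a)).
  { apply (is_RInt_derive (V := R_CompleteNormedModule)).
    - rewrite Rmin_left by exact Hab. intros x Hx. unfold F, F'.
      generalize (Rpower_pos x s). intros Hp.
      assert (Hd : is_derive (fun t => t / (1 + t)) (Rpower x s) (/ (1 + Rpower x s) ^ 2)).
      { auto_derive; [lra|]. field. lra. }
      evar_last.
      + apply (is_derive_scal (fun t => Rpower t s / (1 + Rpower t s))).
        apply (is_derive_comp (fun t => t / (1 + t)) (fun t => Rpower t s)); [exact Hd|].
        apply is_derive_Rpower. lra.
      + unfold scal; simpl; unfold mult; simpl. field. lra.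
    - rewrite Rmin_left by exact Hab. intros x Hx. unfold F'.
      assert (0 < x) by lra. generalize (Rpower_pos x s). intros Hp.
      apply (ex_derive_continuous (V := R_NormedModule)).
      unfold Rpower in *. auto_derive. repeat split; try lra. nra. }
  apply Rle_trans with (F b - F a).
  - eapply is_RInt_le; [exact Hab| |exact HF|].
    + apply (RInt_correct (V := R_CompleteNormedModule)), gamma_integrand_ex_RInt; assumption.
    + intros x Hx. unfold gamma_integrand, F'.
      assert (Hx0 : 0 < x) by lra.
      replace (4 * Rpower x (s - 1) / (1 + Rpower x s) ^ 2)
        with (Rpower x (s - 1) * (4 / (1 + Rpower x s) ^ 2)).
      2: { field. generalize (Rpower_pos x s); lra. }
      (* The constant 4 comes from 1 + x^s <= 2 + x = 2 (1 + x/2) <= 2 exp(x/2), squared. *)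
      apply Rmult_le_compat_l; [apply Rlt_le, Rpower_pos|].
      generalize (Rpower_pos x s). intros Hp.
      assert (H1 : Rpower x s <= 1 + x).
      { apply Rle_trans with (Rpower (1 + x) s); [apply Rle_Rpower_l; lra|].
        rewrite <- (Rpower_1 (1 + x)) at 2 by lra. apply Rle_Rpower; lra. }
      assert (H2 : 1 + x / 2 <= exp (x / 2)) by apply exp_ineq1_le.
      rewrite exp_Ropp. replace x with (x / 2 + x / 2) at 1 by field.
      rewrite exp_plus.
      apply Rmult_le_reg_r with (exp (x / 2) * exp (x / 2)); [nra|].
      rewrite Rinv_l by nra.
      apply Rmult_le_reg_r with ((1 + Rpower x s) ^ 2); [nra|].
      field_simplify; [|nra]. nra.
  - unfold F. generalize (Rpower_pos a s) (Rpower_pos b s). intros Hpa Hpb.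
    assert (0 <= Rpower a s / (1 + Rpower a s)).
    { apply Rmult_le_pos; [lra|]. apply Rlt_le, Rinv_0_lt_compat; lra. }
    assert (Rpower b s / (1 + Rpower b s) <= 1).
    { apply Rmult_le_reg_r with (1 + Rpower b s); [lra|].
      unfold Rdiv. rewrite Rmult_assoc, Rinv_l; lra. }
    assert (0 < 4 / s) by (apply Rdiv_lt_0_compat; lra). nra.
Qed.

(** Apply ln u <= u at u = t / (2s), chosen so that s u = t/2: the power costs half of the exponent
    and the other half remains as decay. *)
Lemma Rpower_exp_le (s t : R) :
  0 < s -> 0 < t -> Rpower t s * exp (- t) <= Rpower (2 * s) s * exp (- (t / 2)).
Proof.
  intros Hs Ht.
  replace (- (t / 2)) with (t / 2 + - t) by field. rewrite (exp_plus (t / 2)), <- Rmult_assoc.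
  apply Rmult_le_compat_r; [apply Rlt_le, exp_pos|].
  unfold Rpower. rewrite <- exp_plus.
  assert (Hln : ln (t / (2 * s)) <= t / (2 * s)).
  { assert (H0 : 0 < t / (2 * s)) by (apply Rdiv_lt_0_compat; lra).
    generalize (exp_ineq1_le (ln (t / (2 * s)))). rewrite exp_ln by exact H0. lra. }
  assert (Hle : s * ln t <= s * ln (2 * s) + t / 2).
  { replace (ln t) with (ln (2 * s) + ln (t / (2 * s))).
    - replace (t / 2) with (s * (t / (2 * s))) by (field; lra). nra.
    - rewrite <- ln_mult by (try apply Rdiv_lt_0_compat; lra). f_equal. field. lra. }
  destruct Hle as [Hle| ->]; [left; now apply exp_increasing|right; reflexivity].
Qed.

Lemma filterlim_Rpower_exp_infty (s : R) :
  0 < s -> filterlim (fun t => - (Rpower t s * exp (- t))) (Rbar_locally p_infty) (locally 0).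
Proof.
  intros Hs. apply filterlim_R_eps; [apply _|]. intros eps.
  set (K := Rpower (2 * s) s). assert (HK : 0 < K) by apply Rpower_pos.
  generalize (cond_pos eps). intros He.
  (* Beyond this threshold K exp(-t/2) <= K / (1 + t/2) < eps. *)
  exists (2 * K / eps). intros t Ht.
  assert (H0 : 0 < 2 * K / eps) by (apply Rdiv_lt_0_compat; lra).
  assert (Ht0 : 0 < t) by lra.
  assert (H1 : Rpower t s * exp (- t) <= K * exp (- (t / 2))) by now apply Rpower_exp_le.
  assert (H2 : 0 < Rpower t s * exp (- t)).
  { apply Rmult_lt_0_compat; [apply Rpower_pos|apply exp_pos]. }
  rewrite Rminus_0_r, Rabs_Ropp, Rabs_right by lra.
  eapply Rle_lt_trans; [exact H1|].
  assert (H3 : 1 + t / 2 <= exp (t / 2)) by apply exp_ineq1_le.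
  rewrite exp_Ropp.
  apply Rmult_lt_reg_r with (exp (t / 2)); [lra|].
  rewrite Rmult_assoc, Rinv_l by lra. rewrite Rmult_1_r.
  assert (2 * K < t * eps).
  { replace (2 * K) with (2 * K / eps * eps) by (field; lra). apply Rmult_lt_compat_r; lra. }
  nra.
Qed.

Lemma filterlim_Rpower_exp_0 (s : R) :
  0 < s -> filterlim (fun t => - (Rpower t s * exp (- t))) (at_right 0) (locally 0).
Proof.
  intros Hs.
  apply filterlim_R_eps; [apply within_filter; apply locally_filter|]. intros eps.
  generalize (filterlim_R_eps_inv (at_right 0) _ _ (filterlim_Rpower_0 s Hs) eps).
  intros H. generalize (filter_and _ _ H at_right_0_pos). apply filter_imp.
  intros t [Ht Ht0]. generalize (Rpower_pos t s) (exp_pos (- t)). intros Hp Hq.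
  rewrite Rminus_0_r in *. rewrite Rabs_Ropp, Rabs_right by nra.
  rewrite Rabs_right in Ht by lra.
  assert (exp (- t) <= 1) by (rewrite <- exp_0; left; apply exp_increasing; lra). nra.
Qed.

(** Integration by parts: [D] is the derivative of -t^s exp(-t), which tends to 0 at both ends.
    Stated for [is_RInt_gen], so that convergence at s + 1 is obtained together with the value. *)
Lemma gamma_integrand_succ (s l : R) :
  0 < s ->
  is_RInt_gen (gamma_integrand s) (at_right 0) (Rbar_locally p_infty) l ->
  is_RInt_gen (gamma_integrand (s + 1)) (at_right 0) (Rbar_locally p_infty) (s * l).
Proof.
  intros Hs Hl.
  set (D := fun t => gamma_integrand (s + 1) t - s * gamma_integrand s t).
  assert (HD : is_RInt_gen D (at_right 0) (Rbar_locally p_infty) (0 - 0)).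
  { apply is_RInt_gen_primitive with (fun t => - (Rpower t s * exp (- t))); try apply _.
    - exists (fun a => 0 < a < 1) (fun b => 1 < b).
      + apply at_right_0_lt, Rlt_0_1.
      + now exists 1.
      + intros a b Ha Hb. simpl.
        apply (is_RInt_derive (V := R_CompleteNormedModule)
          (fun t => - (Rpower t s * exp (- t))) D).
        * rewrite Rmin_left by lra. intros x Hx.
          unfold D, gamma_integrand. replace (s + 1 - 1) with s by ring.
          evar_last.
          -- apply (is_derive_opp (fun t => Rpower t s * exp (- t))).
             apply (is_derive_mult (fun t => Rpower t s) (fun t => exp (- t))).
             ++ apply is_derive_Rpower. lra.
             ++ auto_derive; [exact I|reflexivity].
             ++ intros; apply Rmult_comm.
          -- unfold opp, plus, mult; simpl. ring.
        * rewrite Rmin_left by lra. intros x Hx. unfold D.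
          apply (continuous_minus (V := R_NormedModule)).
          -- apply gamma_integrand_continuous; lra.
          -- apply (continuous_scal_r (V := R_NormedModule)), gamma_integrand_continuous; lra.
    - now apply filterlim_Rpower_exp_0.
    - now apply filterlim_Rpower_exp_infty. }
  replace (s * l) with (plus (0 - 0) (scal s l))
    by (unfold plus, scal; simpl; unfold mult; simpl; ring).
  apply is_RInt_gen_ext with (fun t => plus (D t) (scal s (gamma_integrand s t))).
  - apply filter_forall. intros ab x _. unfold D, plus, scal; simpl; unfold mult; simpl. ring.
  - apply (is_RInt_gen_plus (V := R_NormedModule)); [exact HD|].
    now apply (is_RInt_gen_scal (V := R_NormedModule)).
Qed.

(** The domination argument covers 0 < s <= 1; integration by parts carries convergence and
    positivity up one unit at a time, by induction on a bound n + 1 for s. *)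
Lemma gamma_integral_pos (s : R) :
  0 < s ->
  exists l, is_RInt_gen (gamma_integrand s) (at_right 0) (Rbar_locally p_infty) l /\ 0 < l.
Proof.
  intros Hs.
  destruct (INR_unbounded s) as [n Hn].
  assert (Hsn : s <= INR n + 1) by lra. clear Hn.
  revert s Hs Hsn. induction n as [|n IH]; intros s Hs Hsn.
  - simpl in Hsn.
    destruct (is_RInt_gen_of_bounded (gamma_integrand s) (4 / s)) as [l [H1 H2]].
    + intros x _. apply Rlt_le, gamma_integrand_pos.
    + intros a b. apply gamma_integrand_ex_RInt.
    + intros a b Ha Hab. apply gamma_integrand_RInt_le; lra.
    + exists l. split; [exact H1|].
      eapply Rlt_le_trans; [|apply (H2 1 2); lra].
      apply RInt_gt_0; [lra| |].
      * intros; apply gamma_integrand_pos.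
      * intros x Hx. apply gamma_integrand_continuous. lra.
  - destruct (Rle_lt_dec s 1) as [H1|H1].
    + apply IH; [exact Hs|]. generalize (pos_INR n). lra.
    + rewrite S_INR in Hsn. destruct (IH (s - 1)) as [l [Hl Hl0]]; [lra|lra|].
      exists ((s - 1) * l). split; [|nra].
      replace (gamma_integrand s) with (gamma_integrand (s - 1 + 1)) by (f_equal; ring).
      apply gamma_integrand_succ; [lra|exact Hl].
Qed.

Lemma Gamma_eq (s l : R) :
  is_RInt_gen (gamma_integrand s) (at_right 0) (Rbar_locally p_infty) l -> Gamma s = l.
Proof.
  intros H. unfold Gamma.
  apply (is_RInt_gen_unique (V := R_CompleteNormedModule)). exact H.
Qed.

Lemma Gamma_pos (s : R) : 0 < s -> 0 < Gamma s.
Proof.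
  intros Hs. destruct (gamma_integral_pos s Hs) as [l [Hl Hl0]]. now rewrite (Gamma_eq s l).
Qed.

Lemma Gamma_succ (s : R) : 0 < s -> Gamma (s + 1) = s * Gamma s.
Proof.
  intros Hs. destruct (gamma_integral_pos s Hs) as [l [Hl _]].
  rewrite (Gamma_eq s l Hl). now apply Gamma_eq, gamma_integrand_succ.
Qed.

Lemma Gamma_1 : Gamma 1 = 1.
Proof.
  apply Gamma_eq.
  assert (H : is_RInt_gen (fun t => exp (- t)) (at_right 0) (Rbar_locally p_infty) (0 - - 1)).
  { apply is_RInt_gen_primitive with (fun t => - exp (- t)); try apply _.
    - apply filter_forall. intros [a b]. simpl.
      apply (is_RInt_derive (V := R_CompleteNormedModule)
        (fun t => - exp (- t)) (fun t => exp (- t))).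
      + intros x _. auto_derive; [exact I|ring].
      + intros x _. apply (ex_derive_continuous (V := R_NormedModule)). auto_derive. exact I.
    - assert (Hc : continuous (fun t => - exp (- t)) 0).
      { apply (ex_derive_continuous (V := R_NormedModule)). auto_derive. exact I. }
      unfold continuous in Hc. rewrite Ropp_0, exp_0 in Hc.
      eapply filterlim_filter_le_1; [|exact Hc]. apply filter_le_within.
    - apply filterlim_R_eps; [apply _|]. intros eps. exists (/ eps). intros t Ht.
      generalize (cond_pos eps) (exp_pos (- t)). intros He Hp.
      assert (0 < / eps) by now apply Rinv_0_lt_compat.
      rewrite Rminus_0_r, Rabs_Ropp, Rabs_right by lra.
      rewrite exp_Ropp. rewrite <- (Rinv_inv eps).
      apply Rinv_lt_contravar; [apply Rmult_lt_0_compat; [lra|apply exp_pos]|].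
      generalize (exp_ineq1_le t). lra. }
  replace 1 with (0 - -1) at 2 by ring.
  eapply is_RInt_gen_ext; [|exact H].
  exists (fun a => 0 < a < 1) (fun b => 1 < b).
  - apply at_right_0_lt, Rlt_0_1.
  - now exists 1.
  - intros a b Ha Hb x. simpl. rewrite Rmin_left by lra. intros Hx.
    unfold gamma_integrand. rewrite Rminus_diag, Rpower_O by lra. ring.
Qed.

(** * The recurrence ratios *)

(* The monomial t^n has L-derivative t^(n-1) / lcoef a n for n >= 1, so these
   are the ratios of the power series recurrence. *)
Definition lcoef (a : R) (n : nat) : R :=
  Gamma (INR n + 1 - a) / (Gamma (2 - a) * Gamma (INR n + 1)).

Lemma lcoef_pos (a : R) (n : nat) : 0 < a < 1 -> 0 < lcoef a n.
Proof.
  intros Ha. generalize (pos_INR n). intros Hn.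
  apply Rdiv_lt_0_compat; [|apply Rmult_lt_0_compat]; apply Gamma_pos; lra.
Qed.

(** This is the purpose of the factor Gamma(2 - a): the L-derivative of t is 1, so the power series
    recurrence agrees with the prescribed value x'(0) at t = 0. *)
Lemma lcoef_1 (a : R) : 0 < a < 1 -> lcoef a 1 = 1.
Proof.
  intros Ha. unfold lcoef. simpl INR.
  rewrite (Gamma_succ 1), Gamma_1 by lra.
  replace (1 + 1 - a) with (2 - a) by ring.
  generalize (Gamma_pos (2 - a) ltac:(lra)). intros H. field. lra.
Qed.

Lemma lcoef_succ (a : R) (n : nat) :
  0 < a < 1 -> lcoef a (S n) = lcoef a n * (1 - a / (INR n + 1)).
Proof.
  intros Ha. unfold lcoef. generalize (pos_INR n). intros Hn. rewrite S_INR.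
  replace (INR n + 1 + 1 - a) with (INR n + 1 - a + 1) by ring.
  rewrite !Gamma_succ by lra.
  generalize (Gamma_pos (2 - a) ltac:(lra)) (Gamma_pos (INR n + 1) ltac:(lra)).
  intros H1 H2. field. lra.
Qed.

Lemma Gamma_ratio (a : R) : 0 < a < 1 -> Gamma (2 - a) = (1 - a) * Gamma (1 - a).
Proof. intros Ha. rewrite <- Gamma_succ by lra. f_equal. ring. Qed.

(* 1 - a/m <= exp (-a/m) <= (m/(m+1))^a *)
Lemma lcoef_decay (a : R) (n : nat) :
  0 < a < 1 -> lcoef a n * Rpower (INR n + 1) a <= / (1 - a).
Proof.
  intros Ha. induction n as [|n IH].
  (* The constant of the bound is [lcoef a 0] = Gamma(1 - a) / Gamma(2 - a) itself. *)
  - unfold lcoef. simpl INR. rewrite !Rplus_0_l, Gamma_1, Gamma_ratio by exact Ha.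
    unfold Rpower. rewrite ln_1, Rmult_0_r, exp_0.
    generalize (Gamma_pos (1 - a) ltac:(lra)). intros H. right. field. lra.
  - eapply Rle_trans; [|exact IH].
    rewrite lcoef_succ by exact Ha. rewrite Rmult_assoc.
    apply Rmult_le_compat_l; [now apply Rlt_le, lcoef_pos|].
    rewrite S_INR. set (m := INR n + 1).
    assert (Hm : 0 < m) by (generalize (pos_INR n); unfold m; lra).
    assert (H1 : 1 - a / m <= exp (- (a / m))) by (generalize (exp_ineq1_le (- (a / m))); lra).
    assert (H2 : ln (m + 1) <= ln m + / m).
    { replace (m + 1) with (m * (1 + / m)) by (field; lra).
      assert (0 < / m) by now apply Rinv_0_lt_compat.
      rewrite ln_mult by lra.
      generalize (exp_ineq1_le (ln (1 + / m))). rewrite exp_ln by lra. lra. }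
    eapply Rle_trans.
    + apply Rmult_le_compat_r; [apply Rlt_le, Rpower_pos|exact H1].
    + unfold Rpower. rewrite <- exp_plus.
      assert (H3 : - (a / m) + a * ln (m + 1) <= a * ln m).
      { unfold Rdiv. nra. }
      destruct H3 as [H3|H3]; [left; now apply exp_increasing|right; now f_equal].
Qed.

Lemma lcoef_small (a eps : R) :
  0 < a < 1 -> 0 < eps -> exists N, forall n, (N <= n)%nat -> lcoef a n <= eps.
Proof.
  intros Ha He.
  (* [B] solves B^a = 1 / ((1 - a) eps), where the decay bound drops to eps. *)
  set (B := Rpower (/ ((1 - a) * eps)) (/ a)).
  destruct (INR_unbounded B) as [N HN]. exists N. intros n Hn.
  assert (HB : 0 < B) by apply Rpower_pos.
  assert (HnN : INR N <= INR n) by now apply le_INR.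
  assert (Hx : 0 < / ((1 - a) * eps)) by (apply Rinv_0_lt_compat; nra).
  assert (H1 : / ((1 - a) * eps) <= Rpower (INR n + 1) a).
  { replace (/ ((1 - a) * eps)) with (Rpower B a).
    - apply Rle_Rpower_l; lra.
    - unfold B. rewrite Rpower_mult, Rinv_l, Rpower_1; lra. }
  generalize (lcoef_decay a n Ha) (lcoef_pos a n Ha). intros H2 H3.
  assert (H4 : lcoef a n * / ((1 - a) * eps) <= / (1 - a)) by nra.
  apply Rmult_le_reg_r with (/ ((1 - a) * eps)); [exact Hx|].
  replace (eps * / ((1 - a) * eps)) with (/ (1 - a)) by (field; lra). exact H4.
Qed.

(** * Summability from an eventual contraction *)

Lemma sum_n_succ (u : nat -> R) (n : nat) : sum_n u (S n) = sum_n u n + u (S n).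
Proof. exact (sum_Sn u n). Qed.

Lemma ex_series_of_bounded (r : nat -> R) (M : R) :
  (forall n, 0 <= r n) -> (forall N, sum_n r N <= M) -> ex_series r.
Proof.
  intros Hr HM. destruct (ex_finite_lim_seq_incr (sum_n r) M) as [l Hl].
  - intros n. rewrite sum_n_succ. generalize (Hr (S n)). lra.
  - exact HM.
  - exists l. exact Hl.
Qed.

Lemma sum_n_le_Series (tau : nat -> R) (N : nat) :
  (forall n, 0 <= tau n) -> ex_series tau -> sum_n tau N <= Series tau.
Proof.
  intros Ht Hex.
  generalize (series_tail_le tau tau N (fun n => Req_le _ _ (Rabs_right _ (Rle_ge _ _ (Ht n)))) Hex).
  generalize (Rabs_pos (Series tau - sum_n tau N)). lra.
Qed.

(** Summing the inequality from N on gives S_(M+1) <= r_N + S_M / 2 + sum tau for the partial sums.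
    The bound 2 (r_N + sum tau) is the fixed point of this affine map, hence is preserved by
    induction. *)
Lemma ex_series_contraction (r q tau : nat -> R) (N : nat) :
  (forall n, 0 <= r n) -> (forall n, 0 <= tau n) ->
  (forall n, (N <= n)%nat -> r (S n) <= / 2 * r n + tau n) ->
  ex_series tau -> ex_series r.
Proof.
  intros Hr Ht Hrec Hex.
  apply (ex_series_incr_n r N).
  apply (ex_series_incr_n tau N) in Hex.
  set (t' := fun k => tau (N + k)%nat) in *.
  apply ex_series_of_bounded with (2 * (r N + Series t')); [intros; apply Hr|].
  assert (Ht' : forall n, 0 <= t' n) by (intros; apply Ht).
  intros n. induction n as [|M IH].
  - rewrite sum_O, Nat.add_0_r.
    generalize (sum_n_le_Series t' 0 Ht' Hex) (Hr N) (Ht' 0%nat). rewrite sum_O. lra.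
  - assert (H : forall M, sum_n (fun k => r (N + k)%nat) (S M)
                  <= r N + / 2 * sum_n (fun k => r (N + k)%nat) M + sum_n t' M).
    { clear M IH. induction M as [|M IH].
      - pose proof (Hrec N (Nat.le_refl N)) as H.
        rewrite sum_n_succ, !sum_O. unfold t'.
        rewrite !Nat.add_0_r. replace (N + 1)%nat with (S N) by lia. lra.
      - pose proof (Hrec (N + S M)%nat ltac:(lia)) as H.
        rewrite (sum_n_succ (fun k => r (N + k)%nat) (S M)).
        rewrite (sum_n_succ (fun k => r (N + k)%nat) M) in IH |- *.
        rewrite (sum_n_succ t' M). change (t' (S M)) with (tau (N + S M)%nat).
        replace (N + S (S M))%nat with (S (N + S M)) by lia. lra. }
    generalize (H M) (sum_n_le_Series t' M Ht' Hex). lra.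
Qed.

(** * Finite sums and matrices *)

Lemma sumC_ext (n : nat) (f g : nat -> C) :
  (forall i, (i < n)%nat -> f i = g i) -> sumC n f = sumC n g.
Proof.
  induction n as [|n IH]; intros H; [reflexivity|].
  simpl. rewrite IH, H by (intros; try apply H; lia). reflexivity.
Qed.

Lemma sumC_plus (n : nat) (f g : nat -> C) :
  sumC n (fun i => f i + g i)%C = (sumC n f + sumC n g)%C.
Proof. induction n as [|n IH]; simpl; [ring|rewrite IH; ring]. Qed.

Lemma sumC_mult_l (n : nat) (c : C) (f : nat -> C) :
  sumC n (fun i => c * f i)%C = (c * sumC n f)%C.
Proof. induction n as [|n IH]; simpl; [ring|rewrite IH; ring]. Qed.

Lemma sumC_mult_r (n : nat) (c : C) (f : nat -> C) :
  sumC n (fun i => f i * c)%C = (sumC n f * c)%C.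
Proof. induction n as [|n IH]; simpl; [ring|rewrite IH; ring]. Qed.

Lemma sumC_0 (n : nat) : sumC n (fun _ => RtoC 0) = RtoC 0.
Proof. induction n as [|n IH]; simpl; [reflexivity|rewrite IH; ring]. Qed.

Lemma sumC_swap (n m : nat) (f : nat -> nat -> C) :
  sumC n (fun i => sumC m (f i)) = sumC m (fun j => sumC n (fun i => f i j)).
Proof.
  induction n as [|n IH]; simpl; [now rewrite sumC_0|].
  now rewrite IH, <- sumC_plus.
Qed.

Lemma sumC_first (n : nat) (f : nat -> C) :
  sumC (S n) f = (f O + sumC n (fun i => f (S i)))%C.
Proof.
  induction n as [|n IH]; [simpl; ring|].
  change (sumC (S (S n)) f) with (sumC (S n) f + f (S n))%C. rewrite IH. simpl. ring.
Qed.

Lemma sumR_le (n : nat) (f g : nat -> R) :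
  (forall i, (i < n)%nat -> f i <= g i) -> sumR n f <= sumR n g.
Proof.
  induction n as [|n IH]; intros H; simpl; [lra|].
  apply Rplus_le_compat; [apply IH; intros; apply H; lia|apply H; lia].
Qed.

Lemma sumR_ge_0 (n : nat) (f : nat -> R) : (forall i, 0 <= f i) -> 0 <= sumR n f.
Proof. intros H. induction n as [|n IH]; simpl; [lra|generalize (H n); lra]. Qed.

Lemma sumR_ge_term (n : nat) (f : nat -> R) (i : nat) :
  (forall i, 0 <= f i) -> (i < n)%nat -> f i <= sumR n f.
Proof.
  intros H. induction n as [|n IH]; intros Hi; [lia|]. simpl.
  destruct (Nat.eq_dec i n) as [->|Hn].
  - generalize (sumR_ge_0 n f H). lra.
  - generalize (IH ltac:(lia)) (H n). lra.
Qed.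

Lemma sumR_mult_r (n : nat) (c : R) (f : nat -> R) :
  sumR n (fun i => f i * c) = sumR n f * c.
Proof. induction n as [|n IH]; simpl; [ring|rewrite IH; ring]. Qed.

Lemma sumR_plus (n : nat) (f g : nat -> R) :
  sumR n (fun i => f i + g i) = sumR n f + sumR n g.
Proof. induction n as [|n IH]; simpl; [ring|rewrite IH; ring]. Qed.

Lemma Cmod_sumC (n : nat) (f : nat -> C) : Cmod (sumC n f) <= sumR n (fun i => Cmod (f i)).
Proof.
  induction n as [|n IH]; simpl; [rewrite Cmod_0; lra|].
  eapply Rle_trans; [apply Cmod_triangle|lra].
Qed.

Lemma mvmul_ext (d : nat) (A : nat -> nat -> C) (v w : nat -> C) (i : nat) :
  (forall j, (j < d)%nat -> v j = w j) -> mvmul d A v i = mvmul d A w i.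
Proof. intros H. apply sumC_ext. intros j Hj. now rewrite H. Qed.

Lemma mvmul_plus (d : nat) (A : nat -> nat -> C) (v w : nat -> C) (i : nat) :
  mvmul d A (fun j => v j + w j)%C i = (mvmul d A v i + mvmul d A w i)%C.
Proof. unfold mvmul. rewrite <- sumC_plus. apply sumC_ext. intros; ring. Qed.

Lemma mvmul_scal (d : nat) (A : nat -> nat -> C) (c : C) (v : nat -> C) (i : nat) :
  mvmul d A (fun j => c * v j)%C i = (c * mvmul d A v i)%C.
Proof. unfold mvmul. rewrite <- sumC_mult_l. apply sumC_ext. intros; ring. Qed.

Lemma mvmul_sumC (d n : nat) (A : nat -> nat -> C) (v : nat -> nat -> C) (i : nat) :
  mvmul d A (fun j => sumC n (fun k => v k j)) i = sumC n (fun k => mvmul d A (v k) i).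
Proof.
  unfold mvmul. rewrite sumC_swap. apply sumC_ext. intros j _. now rewrite sumC_mult_l.
Qed.

Lemma mvmul_mmul (d : nat) (A B : nat -> nat -> C) (v : nat -> C) (i : nat) :
  mvmul d (mmul d A B) v i = mvmul d A (mvmul d B v) i.
Proof.
  unfold mvmul, mmul.
  transitivity (sumC d (fun j => sumC d (fun k => A i k * (B k j * v j))%C)).
  - apply sumC_ext. intros j _. rewrite <- sumC_mult_r. apply sumC_ext. intros; ring.
  - rewrite sumC_swap. apply sumC_ext. intros k _. now rewrite sumC_mult_l.
Qed.

Lemma mvmul_idm (d : nat) (v : nat -> C) (i : nat) : (i < d)%nat -> mvmul d idm v i = v i.
Proof.
  unfold mvmul, idm. intros Hi.
  (* The length of the sum is freed from d so that induction applies: the entry [v i] appears as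
     soon as the length exceeds i. *)
  assert (H : forall n, sumC n (fun j => ((if Nat.eqb i j then RtoC 1 else RtoC 0) * v j)%C)
              = if Nat.ltb i n then v i else RtoC 0).
  { induction n as [|n IH]; [reflexivity|]. simpl sumC. rewrite IH.
    destruct (Nat.ltb_spec i n), (Nat.eqb_spec i n), (Nat.ltb_spec i (S n)); subst; try lia; ring. }
  rewrite H. now rewrite (proj2 (Nat.ltb_lt i d) Hi).
Qed.

(** The l1 norm commutes with entrywise estimates and involves no square root; the Euclidean
    hypothesis on theta is converted to it once, by [norm1_le_vnorm]. *)
Definition norm1 (d : nat) (v : nat -> C) : R := sumR d (fun i => Cmod (v i)).

Lemma norm1_ge_0 (d : nat) (v : nat -> C) : 0 <= norm1 d v.
Proof. apply sumR_ge_0. intros; apply Cmod_ge_0. Qed.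

Lemma Cmod_le_norm1 (d : nat) (v : nat -> C) (i : nat) : (i < d)%nat -> Cmod (v i) <= norm1 d v.
Proof.
  intros Hi. apply (sumR_ge_term d (fun i => Cmod (v i))); [|exact Hi]. intros; apply Cmod_ge_0.
Qed.

(** The sum of the moduli of all entries is a crude operator bound, but it suffices because [lcoef]
    eventually beats any constant. *)
Lemma norm1_mvmul (d : nat) (A : nat -> nat -> C) (v : nat -> C) :
  norm1 d (mvmul d A v) <= sumR d (fun i => norm1 d (A i)) * norm1 d v.
Proof.
  unfold norm1 at 1. rewrite <- sumR_mult_r. apply sumR_le. intros i Hi.
  eapply Rle_trans; [apply Cmod_sumC|].
  unfold norm1 at 1. rewrite <- sumR_mult_r. apply sumR_le. intros j Hj.
  rewrite Cmod_mult. apply Rmult_le_compat_l; [apply Cmod_ge_0|now apply Cmod_le_norm1].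
Qed.

Lemma norm1_le_vnorm (d : nat) (v : nat -> C) : norm1 d v <= INR d * vnorm d v.
Proof.
  assert (H : forall i, (i < d)%nat -> Cmod (v i) <= vnorm d v).
  { intros i Hi. unfold vnorm. rewrite <- (sqrt_pow2 (Cmod (v i))) by apply Cmod_ge_0.
    apply sqrt_le_1_alt.
    apply (sumR_ge_term d (fun i => Cmod (v i) ^ 2)); [|exact Hi]. intros; apply pow2_ge_0. }
  (* [vnorm d v] depends on d as well, so it is frozen as [y] before the induction on d. *)
  unfold norm1. clear - H. revert H. generalize (vnorm d v). intros y.
  induction d as [|d IH]; intros H.
  - simpl; lra.
  - rewrite S_INR. simpl sumR. generalize (H d ltac:(lia)) (IH ltac:(intros; apply H; lia)). lra.
Qed.

(** * The coefficient recurrence *)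

(** Restricted to i < d since [idm] acts as the identity only on the relevant entries. The input
    [th] is a parameter: it is zero for the matrix series and theta for the double sum and for x. *)
Definition lrec (a : R) (d : nat) (A : nat -> nat -> C) (w th : nat -> nat -> C) : Prop :=
  forall n i, (i < d)%nat ->
    w (S n) i = (RtoC (lcoef a (S n)) * (mvmul d A (w n) i + th n i))%C.

Lemma lrec_norm1 (a : R) (d : nat) (A : nat -> nat -> C) (w th : nat -> nat -> C) (n : nat) :
  0 < a < 1 -> lrec a d A w th ->
  norm1 d (w (S n)) <=
    lcoef a (S n) * (sumR d (fun i => norm1 d (A i)) * norm1 d (w n) + norm1 d (th n)).
Proof.
  intros Ha Hrec. generalize (lcoef_pos a (S n) Ha). intros Hc.
  eapply Rle_trans with (lcoef a (S n) * (norm1 d (mvmul d A (w n)) + norm1 d (th n))).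
  - unfold norm1. rewrite <- sumR_plus, Rmult_comm, <- sumR_mult_r.
    apply sumR_le. intros i Hi. rewrite Hrec by exact Hi.
    rewrite Cmod_mult, Cmod_R, Rabs_right, Rmult_comm by lra.
    apply Rmult_le_compat_r; [lra|apply Cmod_triangle].
  - apply Rmult_le_compat_l; [lra|]. apply Rplus_le_compat_r, norm1_mvmul.
Qed.

Lemma lrec_summable (a T : R) (d : nat) (A : nat -> nat -> C) (w th : nat -> nat -> C) :
  0 < a < 1 -> 0 < T -> lrec a d A w th ->
  ex_series (fun n => norm1 d (th n) * T ^ n) ->
  ex_series (fun n => norm1 d (w n) * T ^ n).
Proof.
  intros Ha HT Hrec Hth.
  set (K := sumR d (fun i => norm1 d (A i))).
  assert (HK : 0 <= K) by (apply sumR_ge_0; intros; apply norm1_ge_0).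
  (* Chosen so that T eps (K + 1) = 1/2: then T eps K <= 1/2 contracts the old term and T eps <= 1
     controls the input. The summand 1 keeps [eps] defined when K = 0. *)
  set (eps := / (2 * T * (K + 1))).
  assert (He : 0 < eps) by (apply Rinv_0_lt_compat; apply Rmult_lt_0_compat; lra).
  destruct (lcoef_small a eps Ha He) as [N HN].
  apply (ex_series_contraction _ (fun _ => 0) (fun n => norm1 d (th n) * T ^ n) N).
  - intros n. apply Rmult_le_pos; [apply norm1_ge_0|apply pow_le; lra].
  - intros n. apply Rmult_le_pos; [apply norm1_ge_0|apply pow_le; lra].
  - intros n Hn. simpl pow.
    assert (H1 : lcoef a (S n) <= eps) by (apply HN; lia).
    generalize (lrec_norm1 a d A w th n Ha Hrec). fold K.
    generalize (norm1_ge_0 d (w n)) (norm1_ge_0 d (th n)) (lcoef_pos a (S n) Ha).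
    generalize (norm1 d (w n)) (norm1 d (th n)) (norm1 d (w (S n))) (lcoef a (S n)) H1.
    intros y z u c Hc Hy Hz Hc0 Hu.
    assert (Hp : 0 < T ^ n) by (apply pow_lt; lra).
    assert (H2 : T * eps * (K + 1) = / 2) by (unfold eps; field; lra).
    assert (H3 : u * T <= / 2 * y + z).
    { assert (HKy : 0 <= K * y) by now apply Rmult_le_pos.
      assert (Hu' : u <= eps * (K * y + z)).
      { eapply Rle_trans; [exact Hu|]. apply Rmult_le_compat_r; lra. }
      assert (HuT : u * T <= T * eps * (K * y + z)).
      { rewrite Rmult_comm, Rmult_assoc. apply Rmult_le_compat_l; lra. }
      assert (HTe : 0 < T * eps) by now apply Rmult_lt_0_compat.
      set (e := T * eps) in *.
      assert (HeK : 0 <= e * K) by (apply Rmult_le_pos; lra).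
      assert (e * z <= 1 * z) by (apply Rmult_le_compat_r; lra).
      assert (e * K * y <= / 2 * y) by (apply Rmult_le_compat_r; lra). lra. }
    replace (u * (T * T ^ n)) with (u * T * T ^ n) by ring.
    replace (/ 2 * (y * T ^ n) + z * T ^ n) with ((/ 2 * y + z) * T ^ n) by ring.
    apply Rmult_le_compat_r; lra.
  - exact Hth.
Qed.

(** [prodR] unfolds from its first factor, whereas passing from n to n + 1 in the coefficient
    formulas appends a last one. *)
Lemma prodR_last (f : nat -> R) (m len : nat) :
  prodR f m (S len) = prodR f m len * f (m + len)%nat.
Proof.
  revert m. induction len as [|len IH]; intros m.
  - simpl. rewrite Nat.add_0_r. ring.
  - change (prodR f m (S (S len))) with (f m * prodR f (S m) (S len)).
    rewrite IH. simpl. replace (m + S len)%nat with (S (m + len)) by lia. ring.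
Qed.

Lemma prodR_pos (f : nat -> R) (m len : nat) :
  (forall j, (m <= j)%nat -> 0 < f j) -> 0 < prodR f m len.
Proof.
  revert m. induction len as [|len IH]; intros m H; simpl; [lra|].
  apply Rmult_lt_0_compat; [apply H; lia|apply IH; intros; apply H; lia].
Qed.

Lemma Ecoef_succ (a : R) (n : nat) :
  0 < a < 1 -> Ecoef a (S n) = lcoef a (S n) * Ecoef a n.
Proof.
  intros Ha. unfold Ecoef, lcoef. rewrite prodR_last. simpl pow.
  replace (1 + n)%nat with (S n) by lia.
  set (P := prodR _ 1 n).
  assert (HP : 0 < P).
  { apply prodR_pos. intros j _. generalize (pos_INR j). intros Hj.
    apply Rdiv_lt_0_compat; apply Gamma_pos; lra. }
  generalize (pos_INR (S n)). intros Hn.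
  generalize (Gamma_pos (2 - a) ltac:(lra)) (Gamma_pos (INR (S n) + 1) ltac:(lra))
    (Gamma_pos (INR (S n) + 1 - a) ltac:(lra)).
  intros H1 H2 H3. generalize (pow_lt _ n H1). intros H4. field. lra.
Qed.

Lemma Scoef_0 (a : R) (n : nat) : Scoef a (S n) 0 = lcoef a (S n).
Proof.
  unfold Scoef, lcoef. rewrite Nat.sub_0_r. cbn [prodR pow].
  rewrite !Rmult_1_r. replace (INR (S n) - a + 1) with (INR (S n) + 1 - a) by ring.
  reflexivity.
Qed.

(** Raising n and k together leaves the first index n - k unchanged, so both products just gain the
    factor j = n + 1. *)
Lemma Scoef_succ (a : R) (n k : nat) :
  0 < a < 1 -> (k < n)%nat -> Scoef a (S n) (S k) = lcoef a (S n) * Scoef a n k.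
Proof.
  intros Ha Hk. unfold Scoef, lcoef. rewrite 2!(prodR_last _ _ (S k)).
  replace (S n - S k)%nat with (n - k)%nat by lia.
  replace (n - k + S k)%nat with (S n) by lia.
  change (Gamma (2 - a) ^ S (S k)) with (Gamma (2 - a) * Gamma (2 - a) ^ S k).
  replace (INR (S n) - a + 1) with (INR (S n) + 1 - a) by ring.
  set (P := prodR (fun j => Gamma (INR j + 1)) (n - k) (S k)).
  assert (HP : 0 < P).
  { apply prodR_pos. intros j _. generalize (pos_INR j). intros Hj. apply Gamma_pos; lra. }
  generalize (pos_INR (S n)). intros Hn.
  generalize (Gamma_pos (2 - a) ltac:(lra)) (Gamma_pos (INR (S n) + 1) ltac:(lra)).
  intros H1 H2. generalize (pow_lt _ (S k) H1). intros H4. field. lra.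
Qed.

Definition Scoefs (d : nat) (a : R) (A theta : nat -> nat -> C) (n i : nat) : C :=
  sumC n (fun k => RtoC (Scoef a n k) * mvmul d (mpow d A k) (theta (n - k - 1)%nat) i)%C.

(** In the coefficient of index n + 1, the term k = 0 contributes theta_n, and each later term is A
    applied to the term k - 1 of index n. *)
Lemma Scoefs_rec (d : nat) (a : R) (A theta : nat -> nat -> C) :
  0 < a < 1 -> lrec a d A (Scoefs d a A theta) theta.
Proof.
  intros Ha n i Hi. unfold Scoefs at 1. rewrite sumC_first, Scoef_0.
  simpl mpow. rewrite mvmul_idm by exact Hi.
  replace (S n - 0 - 1)%nat with n by lia.
  rewrite Cmult_plus_distr_l, Cplus_comm. f_equal.
  unfold Scoefs. rewrite mvmul_sumC, <- sumC_mult_l. apply sumC_ext. intros k Hk.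
  rewrite mvmul_scal, Scoef_succ, RtoC_mult by assumption.
  replace (S n - S k - 1)%nat with (n - k - 1)%nat by lia.
  change (mpow d A (S k)) with (mmul d A (mpow d A k)). rewrite mvmul_mmul. ring.
Qed.

(** Fixing the column j first leaves a sequence of vectors, to which [lrec] applies with zero
    input. *)
Definition Ecoefs (d : nat) (a : R) (A : nat -> nat -> C) (j n i : nat) : C :=
  (RtoC (Ecoef a n) * mpow d A n i j)%C.

Lemma Ecoefs_rec (d : nat) (a : R) (A : nat -> nat -> C) (j : nat) :
  0 < a < 1 -> lrec a d A (Ecoefs d a A j) (fun _ _ => RtoC 0).
Proof.
  intros Ha n i Hi. unfold Ecoefs. rewrite mvmul_scal, Ecoef_succ, RtoC_mult by exact Ha.
  change (mpow d A (S n) i j) with (mvmul d A (fun k => mpow d A n k j) i). ring.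
Qed.

Definition Xcoefs (d : nat) (a : R) (A : nat -> nat -> C) (x0 : nat -> C)
  (theta : nat -> nat -> C) (n i : nat) : C :=
  (sumC d (fun j => Ecoefs d a A j n i * x0 j) + Scoefs d a A theta n i)%C.

Lemma Xcoefs_rec (d : nat) (a : R) (A : nat -> nat -> C) (x0 : nat -> C)
  (theta : nat -> nat -> C) :
  0 < a < 1 -> lrec a d A (Xcoefs d a A x0 theta) theta.
Proof.
  intros Ha n i Hi. unfold Xcoefs. rewrite mvmul_plus.
  rewrite (Scoefs_rec d a A theta Ha n i Hi).
  rewrite mvmul_sumC.
  transitivity (lcoef a (S n) * sumC d (fun j => mvmul d A (fun k => Ecoefs d a A j n k * x0 j) i)
    + lcoef a (S n) * (mvmul d A (Scoefs d a A theta n) i + theta n i))%C; [|ring].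
  f_equal. rewrite <- sumC_mult_l. apply sumC_ext. intros j Hj.
  rewrite (Ecoefs_rec d a A j Ha n i Hi).
  rewrite (mvmul_ext d A (fun k => Ecoefs d a A j n k * x0 j)%C (fun k => x0 j * Ecoefs d a A j n k)%C)
    by (intros; ring).
  rewrite mvmul_scal. ring.
Qed.

Lemma Xcoefs_0 (d : nat) (a : R) (A : nat -> nat -> C) (x0 : nat -> C)
  (theta : nat -> nat -> C) (i : nat) :
  (i < d)%nat -> Xcoefs d a A x0 theta 0 i = x0 i.
Proof.
  intros Hi. unfold Xcoefs, Scoefs, Ecoefs. simpl.
  rewrite <- (mvmul_idm d x0 i Hi). unfold mvmul. rewrite Cplus_0_r.
  apply sumC_ext. intros j _. unfold Ecoef. simpl.
  replace (/ (1 * 1)) with 1 by field. ring.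
Qed.

(** * Termwise Caputo integral of a power series *)

(* Primitive of s^n (t - s)^(-a) on s < t, from the derivative of s^n (t - s)^(1 - a). *)
Fixpoint kprim (a t : R) (n : nat) (s : R) : R :=
  match n with
  | O => - (Rpower (t - s) (1 - a) / (1 - a))
  | S m => (INR n * t * kprim a t m s - s ^ n * Rpower (t - s) (1 - a)) / (INR n + 1 - a)
  end.

Lemma kprim_succ (a t : R) (n : nat) (s : R) :
  kprim a t (S n) s =
    ((INR n + 1) * t * kprim a t n s - s ^ S n * Rpower (t - s) (1 - a)) / (INR n + 2 - a).
Proof. cbn [kprim]. rewrite S_INR. f_equal; ring. Qed.

Lemma is_derive_kernel (p t s : R) :
  s < t -> is_derive (fun s => Rpower (t - s) p) s (- (p * Rpower (t - s) (p - 1))).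
Proof.
  intros Hs. evar_last.
  - apply (is_derive_comp (fun u => Rpower u p) (fun s => t - s)).
    + apply is_derive_Rpower. lra.
    + auto_derive; [exact I|reflexivity].
  - unfold scal; simpl; unfold mult; simpl. ring.
Qed.

Lemma is_derive_kprim (a t : R) (n : nat) (s : R) :
  0 < a < 1 -> s < t -> is_derive (kprim a t n) s (s ^ n * Rpower (t - s) (- a)).
Proof.
  intros Ha Hs.
  assert (HK : is_derive (fun s => Rpower (t - s) (1 - a)) s (- ((1 - a) * Rpower (t - s) (- a)))).
  { replace (- a) with (1 - a - 1) by ring. now apply is_derive_kernel. }
  (* Splitting off one factor t - s expresses the derivative of s^(n+1) (t - s)^(1-a) through the
     integrands of degrees n and n + 1; this is what the recursion of [kprim] solves for. *)
  assert (HR : Rpower (t - s) (1 - a) = (t - s) * Rpower (t - s) (- a)).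
  { rewrite <- Rpower_add1 by lra. f_equal. ring. }
  induction n as [|n IH].
  - simpl. evar_last.
    + apply (is_derive_opp (fun s => Rpower (t - s) (1 - a) / (1 - a))).
      apply (is_derive_ext (fun s => / (1 - a) * Rpower (t - s) (1 - a))).
      { intros u. unfold Rdiv. apply Rmult_comm. }
      apply is_derive_scal. exact HK.
    + unfold opp; simpl. field. lra.
  - generalize (pos_INR n). intros Hn.
    apply (is_derive_ext (fun s => / (INR n + 2 - a) *
      ((INR n + 1) * t * kprim a t n s - s ^ S n * Rpower (t - s) (1 - a)))).
    { intros u. rewrite kprim_succ. apply Rmult_comm. }
    evar_last.
    + apply is_derive_scal.
      apply (is_derive_minus (fun s => (INR n + 1) * t * kprim a t n s)
        (fun s => s ^ S n * Rpower (t - s) (1 - a))).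
      * apply is_derive_scal. exact IH.
      * apply (is_derive_mult (fun s => s ^ S n)).
        -- apply is_derive_pow, is_derive_id.
        -- exact HK.
        -- intros; apply Rmult_comm.
    + unfold minus, plus, opp, mult, one. simpl pred. rewrite S_INR.
      cbn -[pow INR Rpower]. rewrite HR. simpl pow. field. lra.
Qed.

(** The Beta integral t^(n+1-a) B(n+1, 1-a), that is, the integral of s^n (t - s)^(-a) over (0,t),
    written through [lcoef]. *)
Definition kval (a t : R) (n : nat) : R :=
  Rpower t (1 - a) * t ^ n / ((1 - a) * (INR n + 1) * lcoef a (S n)).

(** At s = 0 the boundary term vanishes, leaving the factor (n+1) t / (n+2-a) per step, which
    [lcoef_succ] identifies as the ratio of consecutive [kval]. *)
Lemma kprim_0 (a t : R) (n : nat) : 0 < a < 1 -> kprim a t n 0 = - kval a t n.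
Proof.
  intros Ha. induction n as [|n IH].
  - unfold kval. simpl. rewrite lcoef_1, Rminus_0_r by exact Ha. field. lra.
  - rewrite kprim_succ, IH. unfold kval. rewrite (lcoef_succ a (S n)) by exact Ha.
    generalize (lcoef_pos a (S n) Ha) (pos_INR n). intros Hc Hn.
    rewrite pow_i by lia. rewrite S_INR, <- tech_pow_Rmult. field. repeat split; lra.
Qed.

Lemma Rmult_le_0_npos (x y : R) : 0 <= x -> y <= 0 -> x * y <= 0.
Proof. intros; nra. Qed.

Lemma kprim_npos (a t : R) (n : nat) (s : R) :
  0 < a < 1 -> 0 < t -> 0 <= s -> kprim a t n s <= 0.
Proof.
  intros Ha Ht Hs. generalize (Rpower_pos (t - s) (1 - a)). intros Hp.
  induction n as [|n IH].
  - simpl. assert (0 < Rpower (t - s) (1 - a) / (1 - a)) by (apply Rdiv_lt_0_compat; lra). lra.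
  - rewrite kprim_succ. generalize (pos_INR n) (pow_le s (S n) Hs). intros Hn Hsn.
    assert (0 < / (INR n + 2 - a)) by (apply Rinv_0_lt_compat; lra).
    assert (0 <= (INR n + 1) * t) by (apply Rmult_le_pos; lra).
    assert (0 <= s ^ S n * Rpower (t - s) (1 - a)) by (apply Rmult_le_pos; lra).
    unfold Rdiv. rewrite Rmult_comm. apply Rmult_le_0_npos; [lra|].
    assert ((INR n + 1) * t * kprim a t n s <= 0) by now apply Rmult_le_0_npos. lra.
Qed.

Lemma is_RInt_kernel (a t : R) (n : nat) (x y : R) :
  0 < a < 1 -> x <= y -> y < t ->
  is_RInt (fun s => s ^ n * Rpower (t - s) (- a)) x y (kprim a t n y - kprim a t n x).
Proof.
  intros Ha Hxy Hy.
  apply (is_RInt_derive (V := R_CompleteNormedModule) (kprim a t n)).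
  - rewrite Rmin_left, Rmax_right by exact Hxy. intros s Hs. apply is_derive_kprim; lra.
  - rewrite Rmin_left, Rmax_right by exact Hxy. intros s Hs.
    apply (ex_derive_continuous (V := R_NormedModule)).
    apply (ex_derive_mult (fun s => s ^ n)).
    + auto_derive. exact I.
    + eexists. apply is_derive_kernel. lra.
Qed.

(** The domination needed for the limit x -> 0, y -> t: the integrand is nonnegative, so the
    increment is at most [kprim a t n y] - [kprim a t n 0], where the first term is nonpositive and
    the second is -[kval a t n]. *)
Lemma kprim_diff (a t : R) (n : nat) (x y : R) :
  0 < a < 1 -> 0 <= x -> x <= y -> y < t ->
  0 <= kprim a t n y - kprim a t n x <= kval a t n.
Proof.
  intros Ha Hx Hxy Hy.
  assert (Hpos : forall x y, 0 <= x -> x <= y -> y < t -> 0 <= kprim a t n y - kprim a t n x).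
  { clear x y Hx Hxy Hy. intros x y Hx Hxy Hy.
    eapply is_RInt_ge_0; [exact Hxy|now apply is_RInt_kernel|].
    intros s Hs. apply Rmult_le_pos; [apply pow_le; lra|apply Rlt_le, Rpower_pos]. }
  split; [now apply Hpos|].
  generalize (Hpos 0 x ltac:(lra) Hx ltac:(lra)) (kprim_npos a t n y Ha ltac:(lra) ltac:(lra)).
  rewrite kprim_0 by exact Ha. lra.
Qed.

Lemma filterlim_minus_at_left (t : R) : filterlim (fun s => t - s) (at_left t) (at_right 0).
Proof.
  intros P [eps HP]. exists eps. intros s Hs Hst. apply HP; [|lra].
  change (Rabs (t - s - 0) < eps). change (Rabs (s - t) < eps) in Hs.
  rewrite Rminus_0_r, Rabs_minus_sym. exact Hs.
Qed.

(** Only a left limit is available: [ln 0 = 0] makes [Rpower 0 (1 - a)] equal to 1, so [kprim] does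
    not tend to its value at s = t in general. *)
Lemma filterlim_kprim_left (a t : R) (n : nat) :
  0 < a < 1 -> 0 < t -> filterlim (kprim a t n) (at_left t) (locally 0).
Proof.
  intros Ha Ht.
  assert (HP : filterlim (fun s => Rpower (t - s) (1 - a)) (at_left t) (locally 0)).
  { eapply (filterlim_comp _ _ _ (fun s => t - s) (fun u => Rpower u (1 - a)));
      [apply filterlim_minus_at_left|apply filterlim_Rpower_0; lra]. }
  assert (Hmul : forall c l (f : R -> R), filterlim f (at_left t) (locally l) ->
    filterlim (fun s => c * f s) (at_left t) (locally (c * l))).
  { intros c l f Hf. eapply filterlim_comp; [exact Hf|].
    apply (filterlim_scal_r (K := R_AbsRing) (V := R_NormedModule)). }
  induction n as [|n IH].
  - apply (filterlim_ext (fun s => - / (1 - a) * Rpower (t - s) (1 - a))).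
    { intros s. simpl. unfold Rdiv. ring. }
    replace 0 with (- / (1 - a) * 0) by ring. now apply Hmul.
  - apply (filterlim_ext (fun s => / (INR n + 2 - a) *
      ((INR n + 1) * t * kprim a t n s + - (s ^ S n * Rpower (t - s) (1 - a))))).
    { intros s. rewrite kprim_succ. unfold Rdiv. ring. }
    replace 0 with (/ (INR n + 2 - a) * ((INR n + 1) * t * 0 + - (t ^ S n * 0))) by ring.
    apply Hmul. eapply filterlim_comp_2.
    + apply Hmul. exact IH.
    + eapply (filterlim_comp _ _ _ _ Ropp).
      * eapply (filterlim_comp_2 (fun s => s ^ S n) (fun s => Rpower (t - s) (1 - a)) Rmult).
        -- apply (filterlim_filter_le_1 (F := locally t)); [apply filter_le_within|].
           apply (ex_derive_continuous (V := R_NormedModule) (fun s => s ^ S n)).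
           auto_derive. exact I.
        -- exact HP.
        -- apply (filterlim_mult (K := R_AbsRing)).
      * apply (filterlim_opp (K := R_AbsRing) (V := R_NormedModule)).
    + apply (filterlim_plus (K := R_AbsRing) (V := R_NormedModule)).
Qed.

Lemma filterlim_kprim_right (a t : R) (n : nat) :
  0 < a < 1 -> 0 < t -> filterlim (kprim a t n) (at_right 0) (locally (- kval a t n)).
Proof.
  intros Ha Ht. rewrite <- kprim_0 by exact Ha.
  apply (filterlim_filter_le_1 (F := locally 0)); [apply filter_le_within|].
  apply (ex_derive_continuous (V := R_NormedModule) (kprim a t n)).
  eexists. apply is_derive_kprim; lra.
Qed.

Lemma CV_radius_ge (b : nat -> R) (t : R) :
  ex_series (fun n => Rabs (b n * t ^ n)) -> Rbar_le t (CV_radius b).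
Proof. intros H. apply (Lub_Rbar_correct (CV_disk b)). exact H. Qed.

Lemma is_RInt_gen_caputo_pseries (a t : R) (b : nat -> R) :
  0 < a < 1 -> 0 < t ->
  ex_series (fun n => Rabs (b n * t ^ n)) ->
  ex_series (fun n => Rabs (b (S n) / lcoef a (S n) * t ^ n)) ->
  is_RInt_gen (fun s => Rpower (t - s) (- a) * PSeries (PS_derive b) s) (at_right 0) (at_left t)
    (Rpower t (1 - a) / (1 - a) * Series (fun n => b (S n) / lcoef a (S n) * t ^ n)).
Proof.
  intros Ha Ht Hb Hbc.
  (* The factor n + 1 from differentiation cancels the one in [kval], so the termwise integrals are
     summable exactly under the second series hypothesis. *)
  assert (Hv : forall n, PS_derive b n * kval a t n
    = Rpower t (1 - a) / (1 - a) * (b (S n) / lcoef a (S n) * t ^ n)).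
  { intros n. unfold PS_derive, kval. rewrite S_INR.
    generalize (lcoef_pos a (S n) Ha) (pos_INR n). intros Hc Hn. field. lra. }
  set (h := fun n (xy : R * R) => PS_derive b n * (kprim a t n (snd xy) - kprim a t n (fst xy))).
  set (m := fun n => Rabs (PS_derive b n * kval a t n)).
  assert (Hm : ex_series m).
  { apply (ex_series_ext (fun n => Rpower t (1 - a) / (1 - a) *
      Rabs (b (S n) / lcoef a (S n) * t ^ n))).
    - intros n. unfold m. rewrite Hv, (Rabs_mult (Rpower t (1 - a) / (1 - a))).
      f_equal. symmetry. apply Rabs_right, Rle_ge, Rlt_le, Rdiv_lt_0_compat; [apply Rpower_pos|lra].
    - apply (ex_series_scal (K := R_AbsRing) (V := R_NormedModule)). exact Hbc. }
  rewrite <- Series_scal_l.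
  apply is_RInt_gen_intro with (fun xy => Series (fun n => h n xy)); try apply _.
  - exists (fun x => 0 < x < t / 2) (fun y => t / 2 < y < t).
    + apply at_right_0_lt. lra.
    + apply at_left_gt. lra.
    + intros x y Hx Hy. simpl fst; simpl snd.
      apply is_RInt_ext with (fun s => Series (fun n => Rpower (t - s) (- a) * (PS_derive b n * s ^ n))).
      { intros s _. now rewrite Series_scal_l. }
      (* Both the kernel and s^n increase with s, so the right end y gives the majorant; it is
         summable because y < t lies strictly inside the disk of convergence. *)
      apply is_RInt_series with (fun n => Rpower (t - y) (- a) * Rabs (PS_derive b n * y ^ n)).
      * lra.
      * intros n. unfold h; simpl fst; simpl snd.
        apply is_RInt_ext with (fun s => scal (PS_derive b n) (s ^ n * Rpower (t - s) (- a))).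
        { intros s _. unfold scal; simpl; unfold mult; simpl. ring. }
        apply (is_RInt_scal (V := R_NormedModule)). apply is_RInt_kernel; lra.
      * intros n s Hs. rewrite Rabs_mult, !Rabs_mult.
        rewrite (Rabs_right (Rpower _ _)) by (apply Rle_ge, Rlt_le, Rpower_pos).
        apply Rmult_le_compat; [apply Rlt_le, Rpower_pos| | |].
        -- apply Rmult_le_pos; apply Rabs_pos.
        -- rewrite !Rpower_Ropp. apply Rinv_le_contravar; [apply Rpower_pos|].
           apply Rle_Rpower_l; lra.
        -- apply Rmult_le_compat_l; [apply Rabs_pos|].
           rewrite !Rabs_right by (apply Rle_ge, pow_le; lra). apply pow_incr; lra.
      * apply (ex_series_scal (K := R_AbsRing) (V := R_NormedModule)).
        apply CV_disk_inside. rewrite CV_radius_derive.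
        eapply Rbar_lt_le_trans; [|apply CV_radius_ge, Hb].
        simpl. rewrite Rabs_right; lra.
  - apply (tannery _ h _ m).
    + exists (fun x => 0 < x < t / 2) (fun y => t / 2 < y < t).
      * apply at_right_0_lt. lra.
      * apply at_left_gt. lra.
      * intros x y Hx Hy n. unfold h, m; simpl fst; simpl snd. rewrite !Rabs_mult.
        apply Rmult_le_compat_l; [apply Rabs_pos|].
        generalize (kprim_diff a t n x y Ha ltac:(lra) ltac:(lra) ltac:(lra)). intros H.
        rewrite !Rabs_right; lra.
    + intros n. rewrite <- Hv. unfold h.
      assert (Hd : filterlim (fun xy => kprim a t n (snd xy) - kprim a t n (fst xy))
        (filter_prod (at_right 0) (at_left t)) (locally (kval a t n))).
      { replace (kval a t n) with (0 - - kval a t n) by ring.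
        apply filterlim_primitive;
          [apply _|apply _|now apply filterlim_kprim_right|now apply filterlim_kprim_left]. }
      eapply (filterlim_comp _ _ _ _ (fun z => PS_derive b n * z)); [exact Hd|].
      apply (filterlim_scal_r (K := R_AbsRing) (V := R_NormedModule)).
    + intros n. unfold m. rewrite Hv. apply Rle_refl.
    + exact Hm.
Qed.

(** * Complex power series *)

(** The balls of [C_UniformSpace] are products of real balls, so limits may be taken
    componentwise. *)
Lemma filterlim_C {U : Type} (F : (U -> Prop) -> Prop) {FF : Filter F} (f : U -> C) (l : C) :
  filterlim (fun u => fst (f u)) F (locally (fst l)) ->
  filterlim (fun u => snd (f u)) F (locally (snd l)) ->
  filterlim f F (@locally C_UniformSpace l).
Proof.
  intros H1 H2 P [eps HP].
  pose proof (proj1 (filterlim_locally _ _) H1 eps) as E1.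
  pose proof (proj1 (filterlim_locally _ _) H2 eps) as E2.
  unfold filtermap.
  apply filter_imp with (2 := filter_and _ _ E1 E2).
  intros u [Hu1 Hu2]. apply HP. split; assumption.
Qed.

Lemma is_series_C (u : nat -> C) (l : C) :
  is_series (fun n => fst (u n)) (fst l) -> is_series (fun n => snd (u n)) (snd l) ->
  is_series (K := C_AbsRing) (V := C_NormedModule) u l.
Proof.
  assert (Hs : forall N, fst (sum_n (G := C_AbelianGroup) u N) = sum_n (fun n => fst (u n)) N /\
                         snd (sum_n (G := C_AbelianGroup) u N) = sum_n (fun n => snd (u n)) N).
  { induction N as [|N [IH1 IH2]]; [now rewrite !sum_O|].
    rewrite !sum_Sn, <- IH1, <- IH2. split; reflexivity. }
  intros H1 H2. apply (filterlim_C eventually (sum_n (G := C_AbelianGroup) u)).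
  - eapply filterlim_ext; [|exact H1]. intros N. symmetry. apply Hs.
  - eapply filterlim_ext; [|exact H2]. intros N. symmetry. apply Hs.
Qed.

Lemma is_series_C_unique (u : nat -> C) (l l' : C) :
  is_series (K := C_AbsRing) (V := C_NormedModule) u l ->
  is_series (K := C_AbsRing) (V := C_NormedModule) u l' -> l = l'.
Proof. apply filterlim_locally_unique. Qed.

Lemma is_series_sumC (n : nat) (u : nat -> nat -> C) (l : nat -> C) :
  (forall j, (j < n)%nat -> is_series (K := C_AbsRing) (V := C_NormedModule) (fun k => u k j) (l j)) ->
  is_series (K := C_AbsRing) (V := C_NormedModule) (fun k => sumC n (u k)) (sumC n l).
Proof.
  induction n as [|n IH]; intros H.
  - apply filterlim_ext with (fun _ : nat => RtoC 0); [|apply filterlim_const].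
    intros N. induction N as [|N IH]; [now rewrite sum_O|].
    rewrite sum_Sn, <- IH. symmetry. apply Cplus_0_l.
  - simpl. apply (is_series_plus (K := C_AbsRing) (V := C_NormedModule)).
    + apply IH. intros j Hj. apply H. lia.
    + apply H. lia.
Qed.

Lemma is_derive_C (f g : R -> R) (x l m : R) :
  is_derive f x l -> is_derive g x m ->
  is_derive (K := R_AbsRing) (V := C_R_NormedModule) (fun t => (f t, g t)) x (l, m).
Proof.
  intros Hf Hg.
  apply (is_derive_ext (fun t => plus (scal (f t) ((1, 0) : C_R_NormedModule))
    (scal (g t) ((0, 1) : C_R_NormedModule)))).
  { intros t. unfold plus, scal; simpl. unfold prod_plus, prod_scal, plus, scal; simpl.
    unfold mult; simpl. f_equal; ring. }
  evar_last.
  - apply (is_derive_plus (K := R_AbsRing) (V := C_R_NormedModule)).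
    + apply (is_derive_scal_l (K := R_AbsRing) (V := C_R_NormedModule)). exact Hf.
    + apply (is_derive_scal_l (K := R_AbsRing) (V := C_R_NormedModule)). exact Hg.
  - unfold plus, scal; simpl. unfold prod_plus, prod_scal, plus, scal; simpl.
    unfold mult; simpl. f_equal; ring.
Qed.

Lemma is_RInt_gen_C (f : R -> C) (Fa Fb : (R -> Prop) -> Prop) {FFa : Filter Fa} {FFb : Filter Fb}
  (l : C) :
  is_RInt_gen (fun t => fst (f t)) Fa Fb (fst l) ->
  is_RInt_gen (fun t => snd (f t)) Fa Fb (snd l) ->
  is_RInt_gen (V := C_R_NormedModule) f Fa Fb l.
Proof.
  intros H1 H2 P [eps HP].
  pose proof (H1 _ (locally_ball (fst l) eps)) as E1.
  pose proof (H2 _ (locally_ball (snd l) eps)) as E2.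
  unfold filtermapi in *.
  apply filter_imp with (2 := filter_and _ _ E1 E2).
  intros ab [[y [Hy By]] [z [Hz Bz]]]. exists (y, z). split.
  - now apply (is_RInt_fct_extend_pair (U := R_NormedModule) (V := R_NormedModule)).
  - apply HP. split; assumption.
Qed.

(** Encoded as two real series so that the real theory of convergence radius, derivative and
    integral applies to each component. *)
Definition CPSeries (c : nat -> C) (t : R) : C :=
  (PSeries (fun n => fst (c n)) t, PSeries (fun n => snd (c n)) t).

Lemma Cmod_fst (z : C) : Rabs (fst z) <= Cmod z.
Proof. eapply Rle_trans; [apply Rmax_l|apply Rmax_Cmod]. Qed.

Lemma Cmod_snd (z : C) : Rabs (snd z) <= Cmod z.
Proof. eapply Rle_trans; [apply Rmax_r|apply Rmax_Cmod]. Qed.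

Lemma ex_series_le_R (u v : nat -> R) :
  (forall n, Rabs (u n) <= v n) -> ex_series v -> ex_series u.
Proof. apply (ex_series_le (K := R_AbsRing) (V := R_CompleteNormedModule)). Qed.

Lemma ex_series_pow_le (y : nat -> R) (t T : R) :
  (forall n, 0 <= y n) -> 0 <= t <= T ->
  ex_series (fun n => y n * T ^ n) -> ex_series (fun n => y n * t ^ n).
Proof.
  intros Hy Ht. apply ex_series_le_R. intros n.
  assert (0 <= t ^ n <= T ^ n) by (split; [apply pow_le; lra|apply pow_incr; lra]).
  rewrite Rabs_right; [apply Rmult_le_compat_l; [apply Hy|lra]|].
  apply Rle_ge, Rmult_le_pos; [apply Hy|lra].
Qed.

Lemma ex_series_parts (c : nat -> C) (t : R) :
  0 <= t -> ex_series (fun n => Cmod (c n) * t ^ n) ->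
  ex_series (fun n => Rabs (fst (c n) * t ^ n)) /\ ex_series (fun n => Rabs (snd (c n) * t ^ n)).
Proof.
  intros Ht H. assert (Hp : forall n, 0 <= t ^ n) by (intros; now apply pow_le).
  split; eapply ex_series_le_R; try exact H; intros n; cbv beta;
    rewrite Rabs_Rabsolu, Rabs_mult, (Rabs_right (t ^ n)) by (apply Rle_ge, Hp);
    apply Rmult_le_compat_r; auto using Cmod_fst, Cmod_snd.
Qed.

Lemma is_series_CPSeries (c : nat -> C) (t : R) :
  0 <= t -> ex_series (fun n => Cmod (c n) * t ^ n) ->
  is_series (K := C_AbsRing) (V := C_NormedModule) (fun n => c n * RtoC (t ^ n))%C (CPSeries c t).
Proof.
  intros Ht H. destruct (ex_series_parts c t Ht H) as [H1 H2].
  apply ex_series_Rabs in H1, H2. apply is_series_C; simpl.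
  - eapply is_series_ext; [|exact (Series_correct _ H1)]. intros n. simpl. ring.
  - eapply is_series_ext; [|exact (Series_correct _ H2)]. intros n. simpl. ring.
Qed.

(** [c'] holds the coefficients of the L-derivative. Its summability is a separate hypothesis: it is
    obtained from [c] by dividing by ratios that tend to 0. *)
Lemma is_Caputo_CPSeries (a t : R) (c c' : nat -> C) :
  0 < a < 1 -> 0 < t ->
  (forall n, c (S n) = RtoC (lcoef a (S n)) * c' n)%C ->
  ex_series (fun n => Cmod (c n) * t ^ n) ->
  ex_series (fun n => Cmod (c' n) * t ^ n) ->
  is_Caputo a (CPSeries c) t
    (scal (/ Gamma (1 - a)) (scal (Rpower t (1 - a) / (1 - a)) (CPSeries c' t))).
Proof.
  intros Ha Ht Hcc Hc Hc'.
  destruct (ex_series_parts c t (Rlt_le _ _ Ht) Hc) as [H1 H2].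
  destruct (ex_series_parts c' t (Rlt_le _ _ Ht) Hc') as [H1' H2'].
  assert (E1 : forall n, fst (c (S n)) / lcoef a (S n) = fst (c' n)).
  { intros n. rewrite Hcc. simpl. generalize (lcoef_pos a (S n) Ha). intros. field. lra. }
  assert (E2 : forall n, snd (c (S n)) / lcoef a (S n) = snd (c' n)).
  { intros n. rewrite Hcc. simpl. generalize (lcoef_pos a (S n) Ha). intros. field. lra. }
  exists (fun s => (PSeries (PS_derive (fun n => fst (c n))) s,
                    PSeries (PS_derive (fun n => snd (c n))) s)).
  split.
  - intros s Hs. apply is_derive_C; apply is_derive_PSeries;
      (eapply Rbar_lt_le_trans; [|apply (CV_radius_ge _ t); assumption]);
      simpl; rewrite Rabs_right; lra.
  - exists (scal (Rpower t (1 - a) / (1 - a)) (CPSeries c' t)). split; [|reflexivity].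
    apply is_RInt_gen_C; [apply _|apply _| |].
    + generalize (is_RInt_gen_caputo_pseries a t (fun n => fst (c n)) Ha Ht H1). intros H.
      simpl. unfold scal; simpl; unfold mult; simpl.
      unfold PSeries at 2.
      rewrite (Series_ext (fun k => fst (c' k) * t ^ k)
        (fun n => fst (c (S n)) / lcoef a (S n) * t ^ n)) by (intros; now rewrite E1).
      apply H. eapply ex_series_ext; [|exact H1']. intros n. simpl. now rewrite E1.
    + generalize (is_RInt_gen_caputo_pseries a t (fun n => snd (c n)) Ha Ht H2). intros H.
      simpl. unfold scal; simpl; unfold mult; simpl.
      unfold PSeries at 2.
      rewrite (Series_ext (fun k => snd (c' k) * t ^ k)
        (fun n => snd (c (S n)) / lcoef a (S n) * t ^ n)) by (intros; now rewrite E2).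
      apply H. eapply ex_series_ext; [|exact H2']. intros n. simpl. now rewrite E2.
Qed.

Lemma filterlim_difference_quotient (f : R -> R) (l : R) :
  is_derive f 0 l -> filterlim (fun h => / h * (f h - f 0)) (at_right 0) (locally l).
Proof.
  intros Hf. apply is_derive_Reals in Hf.
  apply filterlim_R_eps; [apply _|]. intros eps.
  destruct (Hf eps (cond_pos eps)) as [delta Hd].
  exists delta. intros h Hh Hh0. change (Rabs (h - 0) < delta) in Hh.
  rewrite Rminus_0_r in Hh. specialize (Hd h ltac:(lra) Hh). rewrite Rplus_0_l in Hd.
  rewrite Rmult_comm. exact Hd.
Qed.

Lemma is_LD_CPSeries (a T t : R) (c c' : nat -> C) :
  0 < a < 1 -> 0 < T -> 0 <= t <= T ->
  (forall n, c (S n) = RtoC (lcoef a (S n)) * c' n)%C ->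
  ex_series (fun n => Cmod (c n) * T ^ n) ->
  ex_series (fun n => Cmod (c' n) * T ^ n) ->
  is_LD a (CPSeries c) t (CPSeries c' t).
Proof.
  intros Ha HT Ht Hcc Hc Hc'. split.
  - intros Ht0.
    exists (scal (/ Gamma (1 - a)) (scal (Rpower t (1 - a) / (1 - a)) (CPSeries c' t))). split.
    + apply is_Caputo_CPSeries; try assumption;
        eapply ex_series_pow_le; try eassumption; intros; apply Cmod_ge_0.
    (* The constants cancel: Gamma(2-a) / t^(1-a) times t^(1-a) / ((1-a) Gamma(1-a)) is 1. *)
    + rewrite Gamma_ratio by exact Ha.
      generalize (Gamma_pos (1 - a) ltac:(lra)) (Rpower_pos t (1 - a)). intros Hg Hp.
      destruct (CPSeries c' t) as [u v].
      unfold scal; simpl. unfold prod_scal, scal; simpl. unfold mult; simpl.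
      f_equal; field; lra.
  - intros ->.
    destruct (ex_series_parts c T (Rlt_le _ _ HT) Hc) as [H1 H2].
    assert (Hd : forall b, ex_series (fun n => Rabs (b n * T ^ n)) ->
      is_derive (PSeries b) 0 (b 1%nat)).
    { intros b Hb. evar_last.
      - apply is_derive_PSeries. eapply Rbar_lt_le_trans; [|apply (CV_radius_ge _ T), Hb].
        simpl. now rewrite Rabs_R0.
      - rewrite PSeries_0. unfold PS_derive. simpl. ring. }
    assert (Hc1 : c 1%nat = c' O).
    { rewrite Hcc, lcoef_1 by exact Ha. ring. }
    apply filterlim_C; [apply _| |]; unfold CPSeries; simpl.
    + rewrite (PSeries_0 (fun n => fst (c' n))), <- Hc1.
      apply (filterlim_difference_quotient (PSeries (fun n => fst (c n)))), (Hd _ H1).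
    + rewrite (PSeries_0 (fun n => snd (c' n))), <- Hc1.
      apply (filterlim_difference_quotient (PSeries (fun n => snd (c n)))), (Hd _ H2).
Qed.

(** * The vector-valued solution *)

Lemma ex_series_norm1_comp (d : nat) (T : R) (w : nat -> nat -> C) (i : nat) :
  0 < T -> (i < d)%nat -> ex_series (fun n => norm1 d (w n) * T ^ n) ->
  ex_series (fun n => Cmod (w n i) * T ^ n).
Proof.
  intros HT Hi. apply ex_series_le_R. intros n.
  assert (0 < T ^ n) by now apply pow_lt.
  rewrite Rabs_right by (apply Rle_ge, Rmult_le_pos; [apply Cmod_ge_0|lra]).
  apply Rmult_le_compat_r; [lra|now apply Cmod_le_norm1].
Qed.

Theorem mainTheorem14 (alpha T : R) (d : nat) (A : nat -> nat -> C) (x0 : nat -> C)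
  (theta : nat -> nat -> C) :
  0 < alpha < 1 -> 0 < T ->
  ex_series (fun n => vnorm d (theta n) * T ^ n) ->
  exists x : R -> nat -> C,
    (* x is given on [0,T] by the stated formula *)
    (forall t, 0 <= t <= T ->
       exists E : nat -> nat -> C, is_Emat d alpha A t E /\
       forall i, (i < d)%nat ->
         exists s : C, is_series (fun n => Sterm d alpha A theta t n i) s /\
         x t i = Cplus (mvmul d E x0 i) s) /\
    (* initial condition *)
    (forall i, (i < d)%nat -> x 0 i = x0 i) /\
    (* the fractional differential equation on [0,T] *)
    (forall t, 0 <= t <= T -> forall i, (i < d)%nat ->
       exists th : C,
         is_series (fun n => Cmult (theta n i) (RtoC (t ^ n))) th /\
         is_LD alpha (fun s => x s i) t (Cplus (mvmul d A (x t) i) th)).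
Proof.
  intros Ha HT Hv.
  assert (HpT : forall n, 0 < T ^ n) by (intros; now apply pow_lt).
  assert (Hth : ex_series (fun n => norm1 d (theta n) * T ^ n)).
  { apply (ex_series_le_R _ (fun n => INR d * (vnorm d (theta n) * T ^ n))).
    - intros n. rewrite Rabs_right, <- Rmult_assoc.
      + apply Rmult_le_compat_r; [apply Rlt_le, HpT|apply norm1_le_vnorm].
      + apply Rle_ge, Rmult_le_pos; [apply norm1_ge_0|apply Rlt_le, HpT].
    - apply (ex_series_scal (K := R_AbsRing) (V := R_NormedModule)), Hv. }
  set (X := Xcoefs d alpha A x0 theta).
  assert (HE : forall j, ex_series (fun n => norm1 d (Ecoefs d alpha A j n) * T ^ n)).
  { intros j. eapply lrec_summable; [exact Ha|exact HT|now apply Ecoefs_rec|].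
    (* The zero input is summable as 0 times the given series. *)
    apply (ex_series_ext (fun n => scal 0 (norm1 d (theta n) * T ^ n))).
    - intros n. replace (norm1 d (fun _ => RtoC 0)) with 0.
      + unfold scal; simpl; unfold mult; simpl. ring.
      + unfold norm1. clear. induction d as [|k IH]; simpl; [reflexivity|].
        rewrite <- IH, Cmod_0. ring.
    - now apply (ex_series_scal (K := R_AbsRing) (V := R_NormedModule)). }
  assert (HS : ex_series (fun n => norm1 d (Scoefs d alpha A theta n) * T ^ n)).
  { eapply lrec_summable; [exact Ha|exact HT|now apply Scoefs_rec|exact Hth]. }
  assert (HX : ex_series (fun n => norm1 d (X n) * T ^ n)).
  { eapply lrec_summable; [exact Ha|exact HT|now apply Xcoefs_rec|exact Hth]. }
  assert (Hser : forall (w : nat -> nat -> C) i t, (i < d)%nat -> 0 <= t <= T ->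
    ex_series (fun n => norm1 d (w n) * T ^ n) ->
    is_series (K := C_AbsRing) (V := C_NormedModule) (fun n => w n i * RtoC (t ^ n))%C
      (CPSeries (fun n => w n i) t)).
  { intros w i t Hi Ht Hw. apply is_series_CPSeries; [lra|].
    apply (ex_series_pow_le (fun n => Cmod (w n i)) t T); [intros; apply Cmod_ge_0|exact Ht|].
    now apply ex_series_norm1_comp with d. }
  (* Taking x as one power series lets the equation be checked on a single recurrence; the stated
     formula follows by adding convergent series and uniqueness of sums. *)
  exists (fun t i => CPSeries (fun n => X n i) t). split; [|split].
  - intros t Ht. exists (fun i j => CPSeries (fun n => Ecoefs d alpha A j n i) t). split.
    + intros i j Hi Hj. eapply is_series_ext; [|exact (Hser _ i t Hi Ht (HE j))].
      intros n. unfold Ecoefs. rewrite RtoC_mult. simpl. ring.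
    + intros i Hi. exists (CPSeries (fun n => Scoefs d alpha A theta n i) t). split.
      * eapply is_series_ext; [|exact (Hser _ i t Hi Ht HS)].
        intros n. unfold Sterm, Scoefs. rewrite <- sumC_mult_r. apply sumC_ext.
        intros k _. rewrite RtoC_mult. ring.
      * eapply is_series_C_unique; [exact (Hser _ i t Hi Ht HX)|].
        eapply is_series_ext.
        2: { apply (is_series_plus (K := C_AbsRing) (V := C_NormedModule)).
             - apply (is_series_sumC d (fun n j => Ecoefs d alpha A j n i * RtoC (t ^ n) * x0 j)%C).
               intros j Hj.
               apply (is_series_ext (fun n => scal (x0 j) (Ecoefs d alpha A j n i * RtoC (t ^ n))%C)).
               { intros n. apply Cmult_comm. }
               rewrite Cmult_comm. apply (is_series_scal (K := C_AbsRing) (V := C_NormedModule)).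
               exact (Hser _ i t Hi Ht (HE j)).
             - exact (Hser _ i t Hi Ht HS). }
        intros n. unfold X, Xcoefs. rewrite Cmult_plus_distr_r, <- sumC_mult_r.
        apply (f_equal2 Cplus); [|reflexivity].
        apply sumC_ext. intros j _. ring.
  - intros i Hi. unfold CPSeries. rewrite !PSeries_0, <- surjective_pairing.
    now apply Xcoefs_0.
  - intros t Ht i Hi. exists (CPSeries (fun n => theta n i) t).
    split; [exact (Hser _ i t Hi Ht Hth)|].
    set (c' := fun n => (mvmul d A (X n) i + theta n i)%C).
    set (K := sumR d (fun i => norm1 d (A i))).
    (* Summability of A x_n + theta_n at T itself is what extends the equation to the endpoint t =
       T. *)
    assert (Hc' : ex_series (fun n => Cmod (c' n) * T ^ n)).
    { apply (ex_series_le_R _ (fun n => plus (scal K (norm1 d (X n) * T ^ n)) (norm1 d (theta n) * T ^ n))).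
      - intros n. specialize (HpT n).
        rewrite Rabs_right by (apply Rle_ge, Rmult_le_pos; [apply Cmod_ge_0|lra]).
        unfold plus, scal; simpl; unfold mult; simpl.
        rewrite <- Rmult_assoc, <- Rmult_plus_distr_r. apply Rmult_le_compat_r; [lra|].
        eapply Rle_trans; [apply Cmod_triangle|]. apply Rplus_le_compat.
        + eapply Rle_trans; [exact (Cmod_le_norm1 d _ i Hi)|apply norm1_mvmul].
        + now apply Cmod_le_norm1.
      - apply (ex_series_plus (K := R_AbsRing) (V := R_NormedModule)); [|exact Hth].
        now apply (ex_series_scal (K := R_AbsRing) (V := R_NormedModule)). }
    assert (Hrhs : (mvmul d A (fun j => CPSeries (fun n => X n j) t) i
      + CPSeries (fun n => theta n i) t)%C = CPSeries c' t).
    { symmetry. eapply is_series_C_unique.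
      - apply is_series_CPSeries; [lra|].
        apply (ex_series_pow_le (fun n => Cmod (c' n)) t T); [intros; apply Cmod_ge_0|exact Ht|exact Hc'].
      - eapply is_series_ext.
        2: { apply (is_series_plus (K := C_AbsRing) (V := C_NormedModule)).
             - apply (is_series_sumC d (fun n j => A i j * (X n j * RtoC (t ^ n)))%C).
               intros j Hj. apply (is_series_scal (K := C_AbsRing) (V := C_NormedModule)).
               exact (Hser _ j t Hj Ht HX).
             - exact (Hser _ i t Hi Ht Hth). }
        intros n. unfold c', mvmul. rewrite Cmult_plus_distr_r, <- sumC_mult_r.
        apply (f_equal2 Cplus); [|reflexivity].
        apply sumC_ext. intros j _. ring. }
    rewrite Hrhs. apply is_LD_CPSeries with T; try assumption.
    + intros n. exact (Xcoefs_rec d alpha A x0 theta Ha n i Hi).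
    + now apply ex_series_norm1_comp with d.
Qed.
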